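(* Let $\mathfrak g$ be a finite-dimensional complex Lie algebra, $H=U(\mathfrak g)$, and let $V$ be a representation (pseudomodule) of a unital differential $H$-pseudoalgebra $R=\mathrm{Diff}\,A$. Then $V=V^0\oplus V^1$ as $R$-modules, where $R*V^0=0$ and $V^1\cong\widetilde M$ for some unitary left $A$-module $M$. Moreover, $V^1$ is irreducible (respectively, indecomposable) if and only if the $A$-module $M$ is irreducible (respectively, indecomposable).
   Context: Ground field $\mathbb C$; $H=U(\mathfrak g)$ has its standard Hopf structure $(\Delta,\varepsilon,S)$, Sweedler notation $\Delta(h)=h_{(1)}\otimes h_{(2)}$. Pseudoalgebras. An associative $H$-pseudoalgebra is a left $H$-module $R$ with a linear map $R\otimes R\to (H\otimes H)\otimes_H R$, $a\otimes b\mapsto a*b$ (where $H$ acts on $H\otimes H$ from the right via $\Delta$), such that $(fa)*(gb)=((f\otimes g)\otimes_H 1)(a*b)$ for $f,g\in H$, and $(a*b)*c=a*(b*c)$ in $H^{\otimes 3}\otimes_H R$. Here, if $d*c=\sum_i\beta_i\otimes_H c_i$, then $(\gamma\otimes_H d)*c=\sum_i(\gamma\otimes 1)(\Delta\otimes\mathrm{id})(\beta_i)\otimes_H c_i$, and if $a*d=\sum_i\beta_i\otimes_H c_i$, then $a*(\gamma\otimes_H d)=\sum_i(1\otimes\gamma)(\mathrm{id}\otimes\Delta)(\beta_i)\otimes_H c_i$, for $\gamma\in H\otimes H$. A representation (module) of $R$ is a left $H$-module $V$ with a map $R\otimes V\to(H\otimes H)\otimes_HV$, $a\otimes v\mapsto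 a*v$, satisfying the same $H$-bilinearity and associativity $(a*b)*v=a*(b*v)$. Dual algebra and $x$-products. $X=H^*=\mathrm{Hom}_{\mathbb C}(H,\mathbb C)$ is a commutative algebra with $\langle xy,h\rangle=\langle x,h_{(1)}\rangle\langle y,h_{(2)}\rangle$ and unit $1=\varepsilon$; it has a coproduct $\Delta:X\to X\hat\otimes X=(H\otimes H)^*$, $\langle x,fg\rangle=\langle x_{(1)},f\rangle\langle x_{(2)},g\rangle$, and antipode $\langle S(x),h\rangle=\langle x,S(h)\rangle$. Writing $a*v=\sum_i(f_i\otimes 1)\otimes_H v_i$, one puts $a_xv=\sum_i\langle S(x),f_i\rangle v_i$ for $x\in X$; similarly $a_xb$ in $R$. Submodules are $H$-submodules $W$ with $a_xw\in W$ for all $a\in R$, $x\in X$, $w\in W$. A module is irreducible if it has no submodules except $0$ and itself, and indecomposable if it is not a direct sum of two nonzero submodules. Differential pseudoalgebras. An $X^{cop}$-algebra is an associative algebra $A$ that is a left $X$-module with $x(ab)=(x_{(2)}a)(x_{(1)}b)$ and such that the annihilator in $X$ of each $a\in A$ has finite codimension. $\mathrm{Diff}\,A$ is the free $H$-module $H\otimes A$ with pseudoproduct determined by $H$-bilinearity and $(1\otimes a)_x(1\otimes b)=1\otimes(a\,x(b))$. Write $\tilde a=1\otimes a$. $\mathrm{Diff}\,A$ is a unital differential pseudoalgebra when $A$ has an identity $1$ with $x(1)=\varepsilon(x)1$, where $\varepsilon(x)=\langle x,1\rangle$; then $e=\tilde 1$ satisfies $e*e=(1\otimes 1)\otimes_He$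 and is its pseudoidentity. Construction $\widetilde M$. Let $\partial_1,\dots,\partial_N$ be a basis of $\mathfrak g$, $\partial^I=\partial_1^{i_1}\cdots\partial_N^{i_N}/(i_1!\cdots i_N!)$ for $I\in\mathbb Z_{\ge0}^N$ the corresponding basis of $H$, and $t^I\in X$ the dual (topological) basis. For a left $A$-module $M$, $\widetilde M=H\otimes M$ is the $\mathrm{Diff}\,A$-module with (writing $\tilde m=1\otimes m$) $$\tilde a*\tilde m=(1\otimes1)\otimes_H\Big(\sum_I\partial^I\,\widetilde{t^I(a)m}\Big),$$ extended by $H$-bilinearity. $M$ is unitary if $1\in A$ acts as the identity on $M$. *)

(* Defs.v *)
From HB Require Import structures.
From mathcomp Require Import all_boot all_order all_algebra.
From mathcomp Require Import complex.
From mathcomp Require Import boolp classical_sets functions cardinality fsbigop.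
From mathcomp Require Import reals.

Set Implicit Arguments.
Unset Strict Implicit.
Unset Printing Implicit Defensive.

Import GRing.Theory.

Local Open Scope ring_scope.
Local Open Scope classical_set_scope.
Local Open Scope quotient_scope.

Definition is_bilinear (K : fieldType) (U V W : lmodType K)
    (f : U -> V -> W) : Prop :=
  (forall v, linear (f^~ v)) /\ (forall u, linear (f u)).

(* The tensor product [U (x)_S V] of a right [S]-module and a left [S]-module, *)
(* over a base field [K]: formal sums of pairs modulo the congruence generated *)
(* by bilinearity and by [(u s, v) ~ (u, s v)]. No axiom is imposed on the     *)
(* actions [ra], [la]; taking scalar multiplications of [K] gives [U (x)_K V]. *)
Section BalancedTensor.
Variables (K : fieldType) (S : Type) (U V : lmodType K).
Variables (ra : U -> S -> U) (la : S -> V -> V).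

Inductive tens_eq : seq (U * V) -> seq (U * V) -> Prop :=
| tens_refl s : tens_eq s s
| tens_sym s1 s2 : tens_eq s1 s2 -> tens_eq s2 s1
| tens_trans s1 s2 s3 : tens_eq s1 s2 -> tens_eq s2 s3 -> tens_eq s1 s3
| tens_cat s1 s2 r1 r2 :
    tens_eq s1 s2 -> tens_eq r1 r2 -> tens_eq (s1 ++ r1) (s2 ++ r2)
| tens_catC s1 s2 : tens_eq (s1 ++ s2) (s2 ++ s1)
| tens_scale k s1 s2 : tens_eq s1 s2 ->
    tens_eq [seq (k *: p.1, p.2) | p <- s1] [seq (k *: p.1, p.2) | p <- s2]
| tens_addl u u' v : tens_eq [:: (u + u', v)] [:: (u, v); (u', v)]
| tens_addr u v v' : tens_eq [:: (u, v + v')] [:: (u, v); (u, v')]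
| tens_0l v : tens_eq [:: (0, v)] [::]
| tens_base k u v : tens_eq [:: (k *: u, v)] [:: (u, k *: v)]
| tens_bal u s v : tens_eq [:: (ra u s, v)] [:: (u, la s v)].

Definition tens_eqb (s1 s2 : seq (U * V)) : bool := `[< tens_eq s1 s2 >].

Lemma tens_eqb_equiv : equiv_class_of tens_eqb.
Proof.
split=> [s|s1 s2|s2 s1 s3].
- exact/asboolP/tens_refl.
- by apply/asboolP/asboolP => /tens_sym.
- by move=> /asboolP h1 /asboolP h2; apply/asboolP; apply: tens_trans h1 h2.
Qed.

Canonical tens_equiv := EquivRelPack tens_eqb_equiv.

Definition tens := {eq_quot tens_equiv}.
HB.instance Definition _ := Choice.on tens.
HB.instance Definition _ := EqQuotient.on tens.

Lemma tens_piP s1 s2 : \pi_tens s1 = \pi_tens s2 <-> tens_eq s1 s2.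
Proof. by split=> [/eqmodP/asboolP|h]; [|apply/eqmodP/asboolP]. Qed.

Lemma tensW (P : tens -> Prop) : (forall s, P (\pi_tens s)) -> forall x, P x.
Proof. by move=> h x; rewrite -[x]reprK. Qed.

Lemma tens_repr s : tens_eq (repr (\pi_tens s)) s.
Proof. by apply/tens_piP; rewrite reprK. Qed.

Definition tens0 : tens := \pi_tens [::].
Definition tens_add (x y : tens) : tens := \pi_tens (repr x ++ repr y).
Definition tens_sc (k : K) (x : tens) : tens :=
  \pi_tens [seq (k *: p.1, p.2) | p <- repr x].

Lemma tens_addE s1 s2 :
  tens_add (\pi_tens s1) (\pi_tens s2) = \pi_tens (s1 ++ s2).
Proof. by apply/tens_piP; apply: tens_cat; apply: tens_repr. Qed.

Lemma tens_scE k s :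
  tens_sc k (\pi_tens s) = \pi_tens [seq (k *: p.1, p.2) | p <- s].
Proof. by apply/tens_piP/tens_scale/tens_repr. Qed.

Lemma tens_addA : associative tens_add.
Proof.
move=> x y z; elim/tensW: x => x; elim/tensW: y => y; elim/tensW: z => z.
by rewrite !tens_addE catA.
Qed.

Lemma tens_addC : commutative tens_add.
Proof.
move=> x y; elim/tensW: x => x; elim/tensW: y => y.
by rewrite !tens_addE; apply/tens_piP/tens_catC.
Qed.

Lemma tens_add0 : left_id tens0 tens_add.
Proof. by move=> x; elim/tensW: x => x; rewrite tens_addE. Qed.

Lemma tens_scDl_pi k l s :
  tens_eq [seq ((k + l) *: p.1, p.2) | p <- s]
    ([seq (k *: p.1, p.2) | p <- s] ++ [seq (l *: p.1, p.2) | p <- s]).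
Proof.
elim: s => [|[u v] s IH] /=; first exact: tens_refl.
apply: (tens_trans (s2 := [:: (k *: u, v); (l *: u, v)] ++ _)).
  rewrite -cat1s; apply: tens_cat; last exact: IH.
  by rewrite scalerDl; apply: tens_addl.
rewrite -cat1s -[X in tens_eq _ X]cat1s [X in tens_eq X _]/=.
rewrite -[(k *: u, v) :: _]cat1s; apply: tens_cat; first exact: tens_refl.
rewrite -[(l *: u, v) :: _]cat1s -[X in tens_eq _ (_ ++ X)]cat1s !catA.
by apply: tens_cat; [apply: tens_catC|apply: tens_refl].
Qed.

Lemma tens_sc0_pi s : tens_eq [seq (0%R *: p.1, p.2) | p <- s] [::].
Proof.
elim: s => [|[u v] s IH] /=; first exact: tens_refl.
rewrite -cat1s -[X in tens_eq _ X]cats0; apply: tens_cat => //.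
by rewrite scale0r; apply: tens_0l.
Qed.

Lemma tens_scDl k l x : tens_sc (k + l) x = tens_add (tens_sc k x) (tens_sc l x).
Proof.
elim/tensW: x => x; rewrite !tens_scE tens_addE; exact/tens_piP/tens_scDl_pi.
Qed.

Lemma tens_sc1 x : tens_sc 1 x = x.
Proof.
elim/tensW: x => x; rewrite tens_scE; congr (\pi_tens _).
by rewrite -[RHS]map_id; apply: eq_map => -[u v] /=; rewrite scale1r.
Qed.

Definition tens_opp (x : tens) : tens := tens_sc (-1) x.

Lemma tens_addN : left_inverse tens0 tens_opp tens_add.
Proof.
move=> x; rewrite /tens_opp -[X in tens_add _ X]tens_sc1 -tens_scDl addNr.
by elim/tensW: x => x; rewrite tens_scE; apply/tens_piP/tens_sc0_pi.
Qed.

HB.instance Definition _ :=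
  GRing.isZmodule.Build tens tens_addA tens_addC tens_add0 tens_addN.

Lemma tens_scA k l x : tens_sc k (tens_sc l x) = tens_sc (k * l) x.
Proof.
elim/tensW: x => x; rewrite !tens_scE -map_comp; congr (\pi_tens _).
by apply: eq_map => -[u v] /=; rewrite scalerA.
Qed.

Lemma tens_scDr : right_distributive tens_sc +%R.
Proof.
move=> k x y; elim/tensW: x => x; elim/tensW: y => y.
by rewrite [_ + _]tens_addE !tens_scE [RHS]tens_addE map_cat.
Qed.

HB.instance Definition _ := GRing.Zmodule_isLmodule.Build K tens
  tens_scA tens_sc1 tens_scDr (fun x k l => tens_scDl k l x).

Definition tpure (u : U) (v : V) : tens := \pi_tens [:: (u, v)].

Lemma tens_pi_sum s : \pi_tens s = \sum_(p <- s) tpure p.1 p.2.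
Proof.
elim: s => [|[u v] s IH]; first by rewrite big_nil.
by rewrite big_cons -IH [RHS]tens_addE.
Qed.

Lemma tens_sum (x : tens) : exists s, x = \sum_(p <- s) tpure p.1 p.2.
Proof. by elim/tensW: x => s; exists s; apply: tens_pi_sum. Qed.

Lemma tpureDl u u' v : tpure (u + u') v = tpure u v + tpure u' v.
Proof. by rewrite [RHS]tens_addE; apply/tens_piP/tens_addl. Qed.

Lemma tpureDr u v v' : tpure u (v + v') = tpure u v + tpure u v'.
Proof. by rewrite [RHS]tens_addE; apply/tens_piP/tens_addr. Qed.

Lemma tpureZl k u v : tpure (k *: u) v = k *: tpure u v.
Proof. by rewrite [RHS]tens_scE. Qed.

Lemma tpureZr k u v : tpure u (k *: v) = k *: tpure u v.
Proof. by rewrite -tpureZl; apply/esym/tens_piP/tens_base. Qed.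

Lemma tpure_bal u s v : tpure (ra u s) v = tpure u (la s v).
Proof. exact/tens_piP/tens_bal. Qed.

Lemma tpure_bilinear : is_bilinear tpure.
Proof.
by split=> [v k u u'|u k v v'];
  rewrite ?tpureDl ?tpureZl ?tpureDr ?tpureZr.
Qed.

(* The extension of [f] from pure tensors; it is independent of the chosen     *)
(* representative when [f] is bilinear and balanced ([tlift_pure], [tlift_lin]). *)
Definition tlift (W : lmodType K) (f : U -> V -> W) (x : tens) : W :=
  \sum_(p <- repr x) f p.1 p.2.

Section Lift.
Variables (W : lmodType K) (f : U -> V -> W).
Hypothesis f_bil : is_bilinear f.
Hypothesis f_bal : forall u s v, f (ra u s) v = f u (la s v).

Lemma tens_eq_lift s1 s2 : tens_eq s1 s2 ->
  \sum_(p <- s1) f p.1 p.2 = \sum_(p <- s2) f p.1 p.2.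
Proof.
have [fl fr] := f_bil.
have fDl u u' v : f (u + u') v = f u v + f u' v.
  by have := fl v 1 u u'; rewrite !scale1r.
have fDr u v v' : f u (v + v') = f u v + f u v'.
  by have := fr u 1 v v'; rewrite !scale1r.
have f0l v : f 0 v = 0 by apply: (addrI (f 0 v)); rewrite -fDl !addr0.
have f0r u : f u 0 = 0 by apply: (addrI (f u 0)); rewrite -fDr !addr0.
have fZl k u v : f (k *: u) v = k *: f u v.
  by have := fl v k u 0; rewrite !addr0 f0l addr0.
have fZr k u v : f u (k *: v) = k *: f u v.
  by have := fr u k v 0; rewrite !addr0 f0r addr0.
elim=> {s1 s2} //=.
- by move=> s1 s2 s3 _ -> _ ->.
- by move=> s1 s2 r1 r2 _ h1 _ h2; rewrite !big_cat h1 h2.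
- by move=> s1 s2; rewrite !big_cat /= addrC.
- move=> k s1 s2 _ h; rewrite !big_map /=.
  under eq_bigr do rewrite fZl.
  by under [RHS]eq_bigr do rewrite fZl; rewrite -!scaler_sumr h.
- by move=> u u' v; rewrite !big_cons !big_nil !addr0 fDl.
- by move=> u v v'; rewrite !big_cons !big_nil !addr0 fDr.
- by move=> v; rewrite big_cons !big_nil addr0 f0l.
- by move=> k u v; rewrite !big_cons !big_nil !addr0 fZl fZr.
- by move=> u s v; rewrite !big_cons !big_nil !addr0 f_bal.
Qed.

Lemma tlift_pi s : tlift f (\pi_tens s) = \sum_(p <- s) f p.1 p.2.
Proof. exact/tens_eq_lift/tens_repr. Qed.

Lemma tlift_pure u v : tlift f (tpure u v) = f u v.
Proof. by rewrite tlift_pi big_cons big_nil addr0. Qed.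

Lemma tlift_lin : linear (tlift f).
Proof.
move=> k x y; elim/tensW: x => x; elim/tensW: y => y.
rewrite [k *: _]tens_scE [_ + _]tens_addE !tlift_pi big_cat big_map /=.
rewrite scaler_sumr; congr (_ + _); apply: eq_bigr => p _.
have := f_bil.1 p.2 k p.1 0; rewrite !addr0 => ->.
suff -> : f 0 p.2 = 0 by rewrite addr0.
have := f_bil.1 p.2 1 0 0; rewrite scale1r addr0 scale1r => h.
by apply: (addrI (f 0 p.2)); rewrite -h addr0.
Qed.

End Lift.

End BalancedTensor.

Arguments tpure {K S U V ra la} u v.
Arguments tlift {K S U V ra la W} f x.

Definition tensor (K : fieldType) (U V : lmodType K) : lmodType K :=
  tens (S := K) (fun (u : U) k => k *: u) (fun k (v : V) => k *: v).

Section Tensor.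
Variables (K : fieldType) (U V : lmodType K).

Definition tprod (u : U) (v : V) : tensor U V := tpure u v.

Lemma tensor_lift_pure (W : lmodType K) (f : U -> V -> W) : is_bilinear f ->
  forall u v, tlift f (tprod u v) = f u v.
Proof.
move=> fb u v; apply: tlift_pure => // {}u k {}v.
have h0 w : f 0 w = 0.
  have := fb.1 w 1 0 0; rewrite scale1r addr0 scale1r => h.
  by apply: (addrI (f 0 w)); rewrite -h addr0.
have h0' w : f w 0 = 0.
  have := fb.2 w 1 0 0; rewrite scale1r addr0 scale1r => h.
  by apply: (addrI (f w 0)); rewrite -h addr0.
have := fb.1 v k u 0; have := fb.2 u k v 0.
by rewrite !addr0 h0 h0' !addr0 => -> ->.
Qed.

Lemma tensor_lift_lin (W : lmodType K) (f : U -> V -> W) : is_bilinear f ->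
  linear (tlift f : tensor U V -> W).
Proof.
move=> fb; apply: tlift_lin => // u k v.
have h0 w : f 0 w = 0.
  have := fb.1 w 1 0 0; rewrite scale1r addr0 scale1r => h.
  by apply: (addrI (f 0 w)); rewrite -h addr0.
have h0' w : f w 0 = 0.
  have := fb.2 w 1 0 0; rewrite scale1r addr0 scale1r => h.
  by apply: (addrI (f w 0)); rewrite -h addr0.
have := fb.1 v k u 0; have := fb.2 u k v 0.
by rewrite !addr0 h0 h0' !addr0 => -> ->.
Qed.

Lemma tensor_sum (x : tensor U V) : exists s, x = \sum_(p <- s) tprod p.1 p.2.
Proof. exact: tens_sum. Qed.

Definition tmul (mU : U -> U -> U) (mV : V -> V -> V)
    (x y : tensor U V) : tensor U V :=
  tlift (fun a b => tlift (fun c d => tprod (mU a c) (mV b d)) y) x.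

End Tensor.

Structure lie_algebra (K : fieldType) := LieAlgebra {
  lie_sort :> vectType K;
  lie_br : lie_sort -> lie_sort -> lie_sort;
  _ : is_bilinear lie_br;
  _ : forall x, lie_br x x = 0;
  _ : forall x y z, lie_br x (lie_br y z) + lie_br y (lie_br z x)
                    + lie_br z (lie_br x y) = 0
}.

(* The enveloping algebra [U(g)], given by its universal property, with its    *)
(* standard Hopf structure: [Delta] and [eps] are the algebra homomorphisms,   *)
(* and [S] the anti-homomorphism, determined by their values on [g].           *)
Structure enveloping (K : fieldType) (g : lie_algebra K) := Enveloping {
  ue_sort :> algType K;
  ue_inj : {linear g -> ue_sort};
  ue_cop : {linear ue_sort -> tensor ue_sort ue_sort};
  ue_eps : {scalar ue_sort};
  ue_S : {linear ue_sort -> ue_sort};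
  ue_injB : forall x y,
    ue_inj (lie_br x y) = ue_inj x * ue_inj y - ue_inj y * ue_inj x;
  ue_univ : forall (B : algType K) (f : {linear g -> B}),
    (forall x y, f (lie_br x y) = f x * f y - f y * f x) ->
    exists2 phi : {lrmorphism ue_sort -> B}, (forall x, phi (ue_inj x) = f x) &
      forall psi : {lrmorphism ue_sort -> B},
        (forall x, psi (ue_inj x) = f x) -> psi =1 phi;
  ue_cop_inj : forall x,
    ue_cop (ue_inj x) = tprod (ue_inj x) 1 + tprod 1 (ue_inj x);
  ue_copM : forall h h', ue_cop (h * h') = tmul *%R *%R (ue_cop h) (ue_cop h');
  ue_cop1 : ue_cop 1 = tprod 1 1;
  ue_eps_inj : forall x, ue_eps (ue_inj x) = 0;
  ue_epsM : forall h h', ue_eps (h * h') = ue_eps h * ue_eps h';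
  ue_eps1 : ue_eps 1 = 1;
  ue_S_inj : forall x, ue_S (ue_inj x) = - ue_inj x;
  ue_SM : forall h h', ue_S (h * h') = ue_S h' * ue_S h;
  ue_S1 : ue_S 1 = 1
}.

Section Dual.
Variables (K : fieldType) (g : lie_algebra K) (H : enveloping g).

Definition dual : Type := {scalar H}.
Definition dual_fun (x : dual) : H -> K := (x : {scalar H}).
Coercion dual_fun : dual >-> Funclass.

HB.instance Definition _ := gen_eqMixin dual.
HB.instance Definition _ := gen_choiceMixin dual.

Lemma dual_ext (x y : dual) : x =1 y -> x = y.
Proof.
case: x => x [[x0] [x1]]; case: y => y [[y0] [y1]] /funext /= e.
rewrite /dual_fun /= in e; subst y.
by rewrite (Prop_irrelevance x0 y0) (Prop_irrelevance x1 y1).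
Qed.

Lemma dualP (x : dual) : scalar x.
Proof. exact: linearP. Qed.

Definition mk_dual (f : H -> K) (hf : scalar f) : dual :=
  HB.pack_for {scalar H} f (GRing.isLinear.Build K H K *%R f hf).

Lemma dual_add_proof (x y : dual) : scalar (fun h => x h + y h).
Proof.
by move=> k h h'; rewrite !dualP mulrDr addrACA.
Qed.
Lemma dual_scale_proof (c : K) (x : dual) : scalar (fun h => c * x h).
Proof. by move=> k h h'; rewrite dualP mulrDr mulrCA. Qed.
Lemma dual_zero_proof : scalar (fun _ : H => 0 : K).
Proof. by move=> k h h'; rewrite mulr0 addr0. Qed.

Definition dual_add x y : dual := mk_dual (dual_add_proof x y).
Definition dual_scale c x : dual := mk_dual (dual_scale_proof c x).
Definition dual_zero : dual := mk_dual dual_zero_proof.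
Definition dual_opp x : dual := dual_scale (-1) x.

Lemma dual_addA : associative dual_add.
Proof. by move=> x y z; apply: dual_ext => h; apply: addrA. Qed.
Lemma dual_addC : commutative dual_add.
Proof. by move=> x y; apply: dual_ext => h; apply: addrC. Qed.
Lemma dual_add0 : left_id dual_zero dual_add.
Proof. by move=> x; apply: dual_ext => h; apply: add0r. Qed.
Lemma dual_addN : left_inverse dual_zero dual_opp dual_add.
Proof.
move=> x; apply: dual_ext => h.
by rewrite -[LHS]/(-1 * x h + x h) mulN1r addNr.
Qed.

HB.instance Definition _ :=
  GRing.isZmodule.Build dual dual_addA dual_addC dual_add0 dual_addN.

Lemma dual_scaleA a b x : dual_scale a (dual_scale b x) = dual_scale (a * b) x.
Proof. by apply: dual_ext => h; apply: mulrA. Qed.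
Lemma dual_scale1 : left_id 1 dual_scale.
Proof. by move=> x; apply: dual_ext => h; apply: mul1r. Qed.
Lemma dual_scaleDr : right_distributive dual_scale +%R.
Proof. by move=> c x y; apply: dual_ext => h; apply: mulrDr. Qed.
Lemma dual_scaleDl x : {morph dual_scale^~ x : a b / a + b}.
Proof. by move=> a b; apply: dual_ext => h; apply: mulrDl. Qed.

HB.instance Definition _ := GRing.Zmodule_isLmodule.Build K dual
  dual_scaleA dual_scale1 dual_scaleDr dual_scaleDl.

Lemma conv_bilinear (x y : dual) :
  is_bilinear (W := K^o) (fun f h : H => x f * y h).
Proof.
split=> [h k f f'|f k h h']; first by rewrite dualP mulrDl -mulrA.
by rewrite dualP mulrDr mulrCA.
Qed.

Lemma conv_proof (x y : dual) : scalar (fun h =>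
  tlift (W := K^o) (fun f f' => x f * y f') (ue_cop H h)).
Proof.
move=> k h h'; rewrite linearP.
exact: (tensor_lift_lin (conv_bilinear x y)).
Qed.

Definition conv (x y : dual) : dual := mk_dual (conv_proof x y).

Definition counit : dual := ue_eps H.

End Dual.

(* By the Poincare-Birkhoff-Witt theorem the [pbw d I] form a basis of [H], so *)
(* that [db_t] exists and is unique for every basis [db_g] of [g].             *)
Section Bases.
Variables (K : fieldType) (g : lie_algebra K) (H : enveloping g).

Definition midx : Type := {ffun 'I_(\dim {:g}) -> nat}.
HB.instance Definition _ := Choice.on midx.

Definition pbw (d : (\dim {:g}).-tuple g) (I : midx) : H :=
  (\prod_(i < \dim {:g}) (I i)`!%:R)^-1 *:
    \prod_(i < \dim {:g}) ue_inj H (tnth d i) ^+ I i.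

Structure dual_bases := DualBases {
  db_g : (\dim {:g}).-tuple g;
  db_t : midx -> dual H;
  db_basis : basis_of {:g} db_g;
  db_dual : forall I J, db_t I (pbw db_g J) = (I == J)%:R
}.

Definition db_pbw (B : dual_bases) : midx -> H := pbw (db_g B).

End Bases.

(* [A] is not assumed unital. In [xcop_act_mul], [x_(1) (x) x_(2)] is          *)
(* expanded along the topological basis [t^I (x) t^J] of [(H (x) H)^*]; the    *)
(* sum has finite support because annihilators have finite codimension.        *)
Structure xcop_algebra (K : fieldType) (g : lie_algebra K) (H : enveloping g)
    (B : dual_bases H) := XcopAlgebra {
  xcop_sort :> lmodType K;
  xcop_mul : xcop_sort -> xcop_sort -> xcop_sort;
  xcop_act : dual H -> xcop_sort -> xcop_sort;
  xcop_mul_bilinear : is_bilinear xcop_mul;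
  xcop_mulA : associative xcop_mul;
  xcop_act_bilinear : is_bilinear xcop_act;
  xcop_act_counit : forall a, xcop_act (counit H) a = a;
  xcop_act_conv : forall x y a,
    xcop_act (conv x y) a = xcop_act x (xcop_act y a);
  xcop_act_mul : forall x a b, xcop_act x (xcop_mul a b) =
    \sum_(IJ \in [set: midx g * midx g])
      x (db_pbw B IJ.1 * db_pbw B IJ.2) *:
        xcop_mul (xcop_act (db_t B IJ.2) a) (xcop_act (db_t B IJ.1) b);
  xcop_finite : forall a, exists (n : nat) (y : 'I_n -> dual H),
    forall x, exists c : 'I_n -> K,
      xcop_act (x - \sum_(i < n) c i *: y i) a = 0
}.

Definition xcop_identity (K : fieldType) (g : lie_algebra K) (H : enveloping g)
    (B : dual_bases H) (A : xcop_algebra B) (e : A) : Prop :=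
  [/\ forall a, xcop_mul e a = a, forall a, xcop_mul a e = a
    & forall x, xcop_act x e = x 1 *: e].

Section Pseudo.
Variables (K : fieldType) (g : lie_algebra K) (H : enveloping g).

Structure hmodule := HModule {
  hm_sort :> lmodType K;
  hact : H -> hm_sort -> hm_sort;
  hact_bilinear : is_bilinear hact;
  hact1 : forall v, hact 1 v = v;
  hactM : forall f h v, hact (f * h) v = hact f (hact h v)
}.

Section Free.
Variable U : lmodType K.

Definition free_act (h : H) : tensor H U -> tensor H U :=
  tlift (fun f u => tprod (h * f) u).

Lemma free_act_aux h :
  is_bilinear (fun (f : H) (u : U) => tprod (h * f) u : tensor H U).
Proof.
have [tl tr] := tpure_bilinear (fun (u : H) k => k *: u)
                              (fun k (v : U) => k *: v).
split=> [u k f f'|f k u u']; last exact: tr.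
by rewrite mulrDr -scalerAr; apply: tl.
Qed.

Lemma free_act_lin h : linear (free_act h).
Proof. exact/tensor_lift_lin/free_act_aux. Qed.

Lemma free_act_pure h f u : free_act h (tprod f u) = tprod (h * f) u.
Proof. exact/tensor_lift_pure/free_act_aux. Qed.

Lemma free_act_sum h (s : seq (H * U)) :
  free_act h (\sum_(p <- s) tprod p.1 p.2) = \sum_(p <- s) tprod (h * p.1) p.2.
Proof.
have fa0 : free_act h 0 = 0.
  have := free_act_lin h 1 0 0; rewrite !scale1r addr0 => e.
  by apply: (addrI (free_act h 0)); rewrite -e addr0.
elim: s => [|p s IH]; first by rewrite !big_nil.
rewrite !big_cons -IH -[in LHS](scale1r (tprod _ _)) free_act_lin scale1r.
by rewrite free_act_pure.
Qed.

Lemma free_act_bilinear : is_bilinear free_act.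
Proof.
split=> [v k f f'|h]; last exact: free_act_lin.
have [s ->] := tensor_sum v; rewrite !free_act_sum scaler_sumr -big_split /=.
apply: eq_bigr => p _; rewrite mulrDl -scalerAl.
exact: (tpure_bilinear _ _).1.
Qed.

Lemma free_act1 v : free_act 1 v = v.
Proof.
have [s ->] := tensor_sum v; rewrite free_act_sum.
by apply: eq_bigr => p _; rewrite mul1r.
Qed.

Lemma free_actM f h v : free_act (f * h) v = free_act f (free_act h v).
Proof.
have [s ->] := tensor_sum v; rewrite !free_act_sum.
transitivity (free_act f (\sum_(p <- [seq (h * p.1, p.2) | p <- s])
                            tprod p.1 p.2)); last by rewrite big_map.
by rewrite free_act_sum big_map; apply: eq_bigr => p _; rewrite mulrA.
Qed.

Definition free_hmod : hmodule := HModule free_act_bilinear free_act1 free_actM.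

Definition tilde (u : U) : free_hmod := tprod 1 u.

End Free.

Definition HH : lmodType K := tensor H H.
Definition HHH : lmodType K := tensor HH H.
Definition mulHH : HH -> HH -> HH := tmul *%R *%R.
Definition mulHHH : HHH -> HHH -> HHH := tmul mulHH *%R.

(* [Delta (x) id] and [id (x) Delta], from [H (x) H] to [H (x) H (x) H]. *)
Definition copl : HH -> HHH := tlift (fun f h => tprod (ue_cop H f) h).
Definition copr : HH -> HHH := tlift (fun f h =>
  tlift (fun h1 h2 => tprod (tprod f h1) h2) (ue_cop H h)).

(* [gamma |-> gamma (x) 1] and [gamma |-> 1 (x) gamma]. *)
Definition injl (gamma : HH) : HHH := tprod gamma 1.
Definition injr : HH -> HHH := tlift (fun f h => tprod (tprod 1 f) h).

Definition cop3 (h : H) : HHH := copl (ue_cop H h).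

(* [(H (x) H) (x)_H V] and [(H (x) H (x) H) (x)_H V]. *)
Definition tens2 (V : hmodule) : lmodType K :=
  tens (fun (beta : HH) h => mulHH beta (ue_cop H h)) (@hact V).
Definition tens3 (V : hmodule) : lmodType K :=
  tens (fun (beta : HHH) h => mulHHH beta (cop3 h)) (@hact V).

Definition tp2 (V : hmodule) (beta : HH) (v : V) : tens2 V := tpure beta v.
Definition tp3 (V : hmodule) (beta : HHH) (v : V) : tens3 V := tpure beta v.

(* [alpha |-> (gamma (x)_H 1) alpha]. *)
Definition lact2 (V : hmodule) (gamma : HH) : tens2 V -> tens2 V :=
  tlift (fun beta v => tp2 (mulHH gamma beta) v).

Definition map2 (V W : hmodule) (phi : V -> W) : tens2 V -> tens2 W :=
  tlift (fun beta v => tp2 beta (phi v)).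

Section Associativity.
Variables (R V : hmodule) (pR : R -> R -> tens2 R) (pV : R -> V -> tens2 V).

(* [d * c] for [d] in [(H (x) H) (x)_H R], and [a * d] for [d] in              *)
(* [(H (x) H) (x)_H V].                                                        *)
Definition pprodl (d : tens2 R) (c : V) : tens3 V :=
  tlift (fun gamma a =>
    tlift (fun beta v => tp3 (mulHHH (injl gamma) (copl beta)) v) (pV a c)) d.
Definition pprodr (a : R) (d : tens2 V) : tens3 V :=
  tlift (fun gamma c =>
    tlift (fun beta v => tp3 (mulHHH (injr gamma) (copr beta)) v) (pV a c)) d.

Definition pseudo_bilinear : Prop :=
  forall f h a v, pV (hact f a) (hact h v) = lact2 (tprod f h) (pV a v).

Definition pseudo_assoc : Prop :=
  forall a b v, pprodl (pR a b) v = pprodr a (pV b v).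

End Associativity.

Structure pseudoalgebra := Pseudoalgebra {
  pa_sort :> hmodule;
  pa_prod : pa_sort -> pa_sort -> tens2 pa_sort;
  pa_linear : is_bilinear pa_prod;
  pa_bilinear : pseudo_bilinear pa_prod;
  pa_assoc : pseudo_assoc pa_prod pa_prod
}.

Structure pseudomodule (R : pseudoalgebra) := Pseudomodule {
  pm_sort :> hmodule;
  pm_prod : R -> pm_sort -> tens2 pm_sort;
  pm_linear : is_bilinear pm_prod;
  pm_bilinear : pseudo_bilinear pm_prod;
  pm_assoc : pseudo_assoc (@pa_prod R) pm_prod
}.

(* [xcoef x (a * v)] is the [x]-product [a_x v]: every element of              *)
(* [(H (x) H) (x)_H V] is a sum of terms [(f (x) 1) (x)_H v], and the value    *)
(* does not depend on the expression chosen.                                   *)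
Definition xcoef (V : hmodule) (x : dual H) (alpha : tens2 V) : V :=
  xget 0 [set w | exists s : seq (H * V),
    alpha = \sum_(p <- s) tp2 (tprod p.1 1) p.2 /\
    w = \sum_(p <- s) x (ue_S H p.1) *: p.2].

Definition subspace (V : lmodType K) (W : set V) : Prop :=
  W 0 /\ forall k u v, W u -> W v -> W (k *: u + v).

Definition pm_submodule (R : pseudoalgebra) (V : pseudomodule R) (W : set V) :=
  [/\ subspace W, forall h w, W w -> W (hact h w)
    & forall a x w, W w -> W (xcoef x (pm_prod a w))].

(* [V = V0 (+) V1] inside an ambient space, for a subspace [V]. *)
Definition direct_sum (E : lmodType K) (V V0 V1 : set E) : Prop :=
  V = [set u + v | u in V0 & v in V1] /\ V0 `&` V1 = [set 0].

(* For a notion [sub] of submodule of [E] and a submodule [V]. *)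
Definition irreducible (E : lmodType K) (sub : set E -> Prop) (V : set E) :=
  forall W, sub W -> W `<=` V -> W = [set 0] \/ W = V.

Definition indecomposable (E : lmodType K) (sub : set E -> Prop) (V : set E) :=
  ~ exists W1 W2, [/\ sub W1, sub W2, W1 <> [set 0], W2 <> [set 0]
                    & direct_sum V W1 W2].

Section Diff.
Variables (B : dual_bases H) (A : xcop_algebra B).

(* [Diff A]: [H]-bilinearity and the [x]-products determine [diff_prod]. *)
Structure Diff := MkDiff {
  diff_prod : free_hmod A -> free_hmod A -> tens2 (free_hmod A);
  diff_linear : is_bilinear diff_prod;
  diff_bilinear : pseudo_bilinear diff_prod;
  diff_assoc : pseudo_assoc diff_prod diff_prod;
  diff_xprod : forall (a b : A) x,
    xcoef x (diff_prod (tilde a) (tilde b)) = tilde (xcop_mul a (xcop_act x b))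
}.

Definition diff_pseudoalgebra (D : Diff) : pseudoalgebra :=
  Pseudoalgebra (diff_linear D) (diff_bilinear D) (@diff_assoc D).

Structure amodule := AModule {
  am_sort :> lmodType K;
  am_act : A -> am_sort -> am_sort;
  am_bilinear : is_bilinear am_act;
  am_mul : forall a b m, am_act (xcop_mul a b) m = am_act a (am_act b m)
}.

Definition unitary (e : A) (M : amodule) : Prop := forall m : M, am_act e m = m.

Definition am_submodule (M : amodule) (W : set M) : Prop :=
  subspace W /\ forall a m, W m -> W (am_act a m).

(* The pseudoaction of [Diff A] on [H (x) M]. *)
Definition tilde_prod (M : amodule) (u : free_hmod A) (v : free_hmod M) :
    tens2 (free_hmod M) :=
  tlift (fun f a => tlift (fun h m =>
    tp2 (V := free_hmod M) (tprod f h)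
      (\sum_(I \in [set: midx g])
        hact (db_pbw B I) (tilde (am_act (xcop_act (db_t B I) a) m)))) v) u.

(* The submodule [V1] of [V] is isomorphic to [H (x) M]. *)
Definition iso_tilde (D : Diff) (V : pseudomodule (diff_pseudoalgebra D))
    (V1 : set V) (M : amodule) : Prop :=
  exists phi : {linear free_hmod M -> V},
    [/\ injective phi, range phi = V1,
        forall h u, phi (hact h u) = hact h (phi u)
      & forall a u, pm_prod (p := V) a (phi u) = map2 phi (tilde_prod a u)].

Definition decomposition (e : A) (D : Diff)
    (V : pseudomodule (diff_pseudoalgebra D)) (V0 V1 : set V) (M : amodule) :
    Prop :=
  [/\ pm_submodule V0 /\ pm_submodule V1, direct_sum setT V0 V1,
      forall (a : diff_pseudoalgebra D) v, V0 v -> pm_prod a v = 0,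
      unitary e M & iso_tilde V1 M].

End Diff.

End Pseudo.

(* Main.v *)
(* For [a] in [R] and [v] in [V] write [a * v] as a sum of [(f (x) g) (x)_H w], *)
(* and put [a o v = sum eps(f) g w] (the x-product at [x = 1]) and              *)
(* [a . v = sum eps(g) f w]. Applying the counit to one of the three slots of   *)
(* associativity gives                                                          *)
(*   (a o b) * v = (id (x) (a o -)) (b * v),   (a . b) * v = a * (b o v),       *)
(*   a * (b . v) = (id (x) (- . v)) (a * b).                                    *)
(* For the pseudoidentity [e], [E = e o -] is an [H]-linear projection with     *)
(* [a * v = a * E v], and its kernel and image are [V^0] and [V^1]. Also        *)
(* [P = e . -] satisfies [P (h v) = eps(h) P v] and [e * P v = (1 (x) 1) (x)_H  *)
(* P v]; its image is [M], with [A] acting by [a m = P (a~ . m)]. The remaining *)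
(* ingredient is the contraction [(a (x) b (x) c) (x)_H v |-> c S(b) a v],      *)
(* which turns [(e * e) * v = e * (e * v)] into the reconstruction formula      *)
(* [E v = sum S(f) P w], where [e * v = sum (f (x) 1) (x)_H w]. So [V^1] is a   *)
(* Hopf module that is free over [H] on [M]. A submodule of [V^1] is stable     *)
(* under [P] and the formula recovers it from its intersection with [M], so     *)
(* submodules of [V^1] and of [M] correspond.                                   *)

Require Import Defs.
From HB Require Import structures.
From mathcomp Require Import all_boot all_order all_algebra.
From mathcomp Require Import complex.
From mathcomp Require Import boolp classical_sets functions cardinality fsbigop.
From mathcomp Require Import reals.

Set Implicit Arguments.
Unset Strict Implicit.
Unset Printing Implicit Defensive.

Import GRing.Theory.

Local Open Scope ring_scope.
Local Open Scope classical_set_scope.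
Local Open Scope quotient_scope.

(** * Bilinear maps and tensor products *)

(** Associativity is an identity in $H^{\otimes 3}\otimes_H V$, and a linear map out of $H^{\otimes
    3}$ that is compatible with right multiplication by the iterated coproduct descends to it. Four
    such maps are applied: the counits of the three slots ([pV_nu], [pV_mu], [pV_dot]) and the
    contraction [tau] ([theta_unit]).

    For the pseudoidentity, [pV_proj] shows that the kernel of [proj] is annihilated, and
    [map2_proj] that all coefficients of pseudoproducts lie in its image. By [theta_proj] the image
    is spanned over $H$ by values of [coinv], so $H\otimes M$ maps onto it ([range_span_map]);
    [unspanK] reads a tensor back from $e*v$, so this map is injective. [dot_expand] identifies the
    pseudoaction with the formula defining $\widetilde M$.

    The data of $\mathrm{Diff}\,A$ and the notion of submodule are given by $x$-products. To pass
    from these to full pseudoproducts, [left_form] identifies $(H\otimes H)\otimes_H V$ with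
    $H\otimes V$, and the spanning half of the Poincare-Birkhoff-Witt theorem ([pbw_span]) writes a
    pseudotensor as a finite combination of its $x$-products at $x=t^I$ ([tens2_expand]). The Hopf
    identities behind all this are checked on generators of $H$ through [ue_ind]. *)

Section Bilinear.
Variables (K : fieldType) (U V W : lmodType K) (f : U -> V -> W).
Hypothesis f_bil : is_bilinear f.

Lemma bilinDl u u' v : f (u + u') v = f u v + f u' v.
Proof. by have := f_bil.1 v 1 u u'; rewrite !scale1r. Qed.

Lemma bilinDr u v v' : f u (v + v') = f u v + f u v'.
Proof. by have := f_bil.2 u 1 v v'; rewrite !scale1r. Qed.

Lemma bilin0l v : f 0 v = 0.
Proof. by apply: (addrI (f 0 v)); rewrite -bilinDl !addr0. Qed.

Lemma bilin0r u : f u 0 = 0.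
Proof. by apply: (addrI (f u 0)); rewrite -bilinDr !addr0. Qed.

Lemma bilinZl k u v : f (k *: u) v = k *: f u v.
Proof. by have := f_bil.1 v k u 0; rewrite !addr0 bilin0l addr0. Qed.

Lemma bilinZr k u v : f u (k *: v) = k *: f u v.
Proof. by have := f_bil.2 u k v 0; rewrite !addr0 bilin0r addr0. Qed.

Lemma bilin_suml I (s : seq I) (F : I -> U) v :
  f (\sum_(i <- s) F i) v = \sum_(i <- s) f (F i) v.
Proof.
by elim: s => [|i s IH]; rewrite ?big_nil ?bilin0l // !big_cons bilinDl IH.
Qed.

Lemma bilin_sumr I (s : seq I) u (F : I -> V) :
  f u (\sum_(i <- s) F i) = \sum_(i <- s) f u (F i).
Proof.
by elim: s => [|i s IH]; rewrite ?big_nil ?bilin0r // !big_cons bilinDr IH.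
Qed.

End Bilinear.

(** Packs a linearity proof so that [linearD], [linearP] and [linear_sum] apply to the maps obtained
    from [tlift]. *)
Definition mk_linear (K : fieldType) (U V : lmodType K) (f : U -> V)
    (f_lin : linear f) : {linear U -> V} :=
  HB.pack_for {linear U -> V} f (GRing.isLinear.Build K U V *:%R f f_lin).
Arguments mk_linear : simpl never.

Section Tens.
Variables (K : fieldType) (S : Type) (U V : lmodType K).
Variables (ra : U -> S -> U) (la : S -> V -> V).
Local Notation T := (tens ra la).

Lemma tens_ind (P : T -> Prop) : P 0 -> (forall x y, P x -> P y -> P (x + y)) ->
  (forall u v, P (tpure u v)) -> forall x, P x.
Proof.
move=> P0 PD Pt x; have [s ->] := tens_sum x.
by elim: s => [|p s IH]; rewrite ?big_nil // big_cons; apply: PD.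
Qed.

Lemma tens_reprE (x : T) : \sum_(p <- repr x) tpure p.1 p.2 = x.
Proof. by rewrite -tens_pi_sum reprK. Qed.

Section Lift.
Variables (W : lmodType K) (f : U -> V -> W).
Hypothesis f_bil : is_bilinear f.
Hypothesis f_bal : forall u s v, f (ra u s) v = f u (la s v).

Definition balift : {linear T -> W} := mk_linear (tlift_lin f_bil f_bal).

Lemma balift_pure u v : balift (tpure u v) = f u v.
Proof. exact: tlift_pure. Qed.

End Lift.
End Tens.

Section Tensor.
Variables (K : fieldType) (U V : lmodType K).

Lemma tensor_ind (P : tensor U V -> Prop) :
  P 0 -> (forall x y, P x -> P y -> P (x + y)) ->
  (forall u v, P (tprod u v)) -> forall x, P x.
Proof. exact: tens_ind. Qed.

Lemma tprodDl u u' v : tprod (u + u') v = tprod u v + tprod u' v :> tensor U V.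
Proof. exact: tpureDl. Qed.

Lemma tprodDr u v v' : tprod u (v + v') = tprod u v + tprod u v' :> tensor U V.
Proof. exact: tpureDr. Qed.

Lemma tprodZl k u v : tprod (k *: u) v = k *: tprod u v :> tensor U V.
Proof. exact: tpureZl. Qed.

Lemma tprodZr k u v : tprod u (k *: v) = k *: tprod u v :> tensor U V.
Proof. exact: tpureZr. Qed.

Lemma tprod_bilinear : is_bilinear (@tprod K U V).
Proof. exact: tpure_bilinear. Qed.

Lemma tprodNl u v : tprod (- u) v = - tprod u v :> tensor U V.
Proof. by rewrite -scaleN1r tprodZl scaleN1r. Qed.

Definition blift (W : lmodType K) (f : U -> V -> W) (f_bil : is_bilinear f) :
  {linear tensor U V -> W} := mk_linear (tensor_lift_lin f_bil).

Lemma blift_pure (W : lmodType K) (f : U -> V -> W) (f_bil : is_bilinear f) u v :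
  blift f_bil (tprod u v) = f u v.
Proof. exact: tensor_lift_pure. Qed.

Section Mul.
Variables (mU : U -> U -> U) (mV : V -> V -> V).
Hypotheses (mU_bil : is_bilinear mU) (mV_bil : is_bilinear mV).

Lemma tmul_bil_pure a b : is_bilinear (fun c d => tprod (mU a c) (mV b d)).
Proof.
split=> [d k c c'|c k d d'].
  by rewrite mU_bil.2 tprodDl tprodZl.
by rewrite mV_bil.2 tprodDr tprodZr.
Qed.

Lemma tmul_bil_inner (y : tensor U V) :
  is_bilinear (fun a b => tlift (fun c d => tprod (mU a c) (mV b d)) y).
Proof.
split=> [b k a a'|a k b b']; rewrite /tlift scaler_sumr -big_split;
    apply: eq_bigr => p _ /=.
  by rewrite mU_bil.1 tprodDl tprodZl.
by rewrite mV_bil.1 tprodDr tprodZr.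
Qed.

Lemma tmul_pure a b c d :
  tmul mU mV (tprod a b) (tprod c d) = tprod (mU a c) (mV b d).
Proof.
rewrite /tmul (tensor_lift_pure (tmul_bil_inner _)).
exact: (tensor_lift_pure (tmul_bil_pure a b)).
Qed.

Lemma tmul_bilinear : is_bilinear (tmul mU mV).
Proof.
split=> [y|x k y y']; first exact: (tensor_lift_lin (tmul_bil_inner y)).
(* With the representative of [x] fixed, linearity in the second argument can be checked term by
   term. *)
have E (z : tensor U V) : tmul mU mV x z = \sum_(p <- repr x)
    tlift (fun c d => tprod (mU p.1 c) (mV p.2 d)) z by [].
rewrite !E scaler_sumr -big_split; apply: eq_bigr => p _ /=.
exact: (tensor_lift_lin (tmul_bil_pure p.1 p.2)).
Qed.

End Mul.
End Tensor.

(** * Induction on the enveloping algebra *)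

Section SubAlgebra.
Variables (K : fieldType) (A : algType K) (S : subalgClosed A).

Definition subalg_type : Type := {x : A | x \in S}.
HB.instance Definition _ := SubChoice.on subalg_type.
HB.instance Definition _ := [SubChoice_isSubAlgebra of subalg_type by <:].

End SubAlgebra.

Section SubModule.
Variables (K : fieldType) (V : lmodType K) (S : submodClosed V).

Definition submod_type : Type := {x : V | x \in S}.
HB.instance Definition _ := SubChoice.on submod_type.
HB.instance Definition _ := [SubChoice_isSubLmodule of submod_type by <:].

End SubModule.

Section Generation.
Variables (K : fieldType) (g : lie_algebra K) (H : enveloping g).

(** The inclusion of $\mathfrak g$ in $S$ extends to a homomorphism $H\to S$. Followed by
    $S\subseteq H$ it is an endomorphism of $H$ fixing $\mathfrak g$, hence the identity by
    uniqueness. *)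
Lemma ue_subalg (S : subalgClosed H) : (forall y, ue_inj H y \in S) ->
  forall h, h \in S.
Proof.
move=> iS h.
have f_lin : linear (fun y => Sub (ue_inj H y) (iS y) : subalg_type S).
  by move=> k x y; apply: val_inj; rewrite /= linearP.
have fE y : val (mk_linear f_lin y) = ue_inj H y by [].
have [|phi phiE _] := @ue_univ _ _ H (subalg_type S) (mk_linear f_lin).
  by move=> x y; apply: val_inj; rewrite /= ue_injB.
have [|psi psiE psiU] := @ue_univ _ _ H H (ue_inj H); first exact: ue_injB.
have id_psi := psiU idfun (fun _ => erefl).
pose f (x : H) : H := val (phi x).
have f_mon : monoid_morphism f.
  by split=> [|x y]; rewrite /f ?rmorph1 ?rmorphM.
have f_lin' : linear f by move=> k x y; rewrite /f !linearP.
pose f' : {lrmorphism H -> H} := HB.pack_for {lrmorphism H -> H} f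
  (GRing.isMonoidMorphism.Build H H f f_mon)
  (GRing.isLinear.Build K H H *:%R f f_lin').
have val_psi := psiU f' (fun y => congr1 val (phiE y)).
by rewrite -[h]/(idfun h) id_psi -val_psi; apply: valP.
Qed.

(** The elements whose left multiplication preserves [P] form a subalgebra containing $\mathfrak g$,
    hence all of $H$; apply this to $h\cdot 1$. *)
Lemma ue_ind (P : H -> Prop) : P 1 ->
  (forall k x y, P x -> P y -> P (k *: x + y)) ->
  (forall y h, P h -> P (ue_inj H y * h)) -> forall h, P h.
Proof.
move=> P1 PL Pm h.
pose S := [pred x : H | `[< forall z, P z -> P (x * z) >]].
have S_alg : GRing.subalg_closed S.
  split.
  - by apply/asboolP => z; rewrite mul1r.
  - move=> k x y /asboolP hx /asboolP hy; apply/asboolP => z Pz.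
    by rewrite mulrDl -scalerAl; apply: PL; auto.
  - move=> x y /asboolP hx /asboolP hy; apply/asboolP => z Pz.
    by rewrite -mulrA; auto.
pose S' : subalgClosed H :=
  HB.pack (S : {pred H}) (GRing.isSubalgClosed.Build K H S S_alg).
have /asboolP hS : h \in S'.
  by apply: (ue_subalg (S := S')) => y; apply/asboolP; apply: Pm.
by rewrite -[h]mulr1; apply: hS.
Qed.

End Generation.

(** * Hopf identities *)

Section Hopf.
Variables (K : fieldType) (g : lie_algebra K) (H : enveloping g).

Local Notation HH := (HH H).
Local Notation HHH := (HHH H).
Local Notation D := (ue_cop H).
Local Notation eps := (ue_eps H).
Local Notation S := (ue_S H).
Local Notation inj := (ue_inj H).
Local Notation t2 a b := (tprod (a : H) (b : H) : HH) (only parsing).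
Local Notation t3 a b c := (tprod (t2 a b) (c : H) : HHH) (only parsing).

Lemma HHH_ind (P : HHH -> Prop) : P 0 ->
  (forall x y, P x -> P y -> P (x + y)) ->
  (forall a b c, P (t3 a b c)) -> forall x, P x.
Proof.
move=> P0 PD Pt; elim/tensor_ind => // u c; elim/tensor_ind: u => //.
  by rewrite (bilin0l (tprod_bilinear _ _)).
by move=> x y Px Py; rewrite tprodDl; apply: PD.
Qed.

Lemma mul_bilinear : is_bilinear (fun x y : H => x * y).
Proof.
split=> [y k x x'|x k y y']; first by rewrite mulrDl scalerAl.
by rewrite mulrDr scalerAr.
Qed.

Lemma mulHH_bilinear : is_bilinear (@mulHH K g H).
Proof. exact: (tmul_bilinear mul_bilinear mul_bilinear). Qed.

Lemma mulHHH_bilinear : is_bilinear (@mulHHH K g H).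
Proof. exact: (tmul_bilinear mulHH_bilinear mul_bilinear). Qed.

Lemma mulHH_pure a b c d : mulHH (t2 a b) (t2 c d) = t2 (a * c) (b * d).
Proof. exact: (tmul_pure mul_bilinear mul_bilinear). Qed.

Lemma mulHHH_pure x c y d :
  mulHHH (tprod x c : HHH) (tprod y d) = tprod (mulHH x y) (c * d).
Proof. exact: (tmul_pure mulHH_bilinear mul_bilinear). Qed.

Definition mulHHDl := bilinDl mulHH_bilinear.
Definition mulHHDr := bilinDr mulHH_bilinear.
Definition mulHH0l := bilin0l mulHH_bilinear.
Definition mulHH0r := bilin0r mulHH_bilinear.
Definition mulHHHDl := bilinDl mulHHH_bilinear.
Definition mulHHHDr := bilinDr mulHHH_bilinear.
Definition mulHHH0l := bilin0l mulHHH_bilinear.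
Definition mulHHH0r := bilin0r mulHHH_bilinear.

Lemma mulHHA : associative (@mulHH K g H).
Proof.
move=> x y z; elim/tensor_ind: x => [|x x' hx hx'|a b].
- by rewrite !mulHH0l.
- by rewrite !mulHHDl hx hx'.
elim/tensor_ind: y => [|y y' hy hy'|c d].
- by rewrite mulHH0l mulHH0r mulHH0l.
- by rewrite mulHHDl mulHHDr hy hy' mulHHDr mulHHDl.
elim/tensor_ind: z => [|z z' hz hz'|e f].
- by rewrite !mulHH0r.
- by rewrite !mulHHDr hz hz'.
by rewrite !mulHH_pure !mulrA.
Qed.

Lemma mul1HH x : mulHH (t2 1 1) x = x.
Proof.
elim/tensor_ind: x => [|x x' hx hx'|a b]; first exact: mulHH0r.
  by rewrite mulHHDr hx hx'.
by rewrite mulHH_pure !mul1r.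
Qed.

Lemma mul1HHH x : mulHHH (injl (t2 1 1)) x = x.
Proof.
elim/tensor_ind: x => [|x x' hx hx'|a b]; first exact: mulHHH0r.
  by rewrite mulHHHDr hx hx'.
by rewrite /injl mulHHH_pure mul1HH mul1r.
Qed.

Lemma ue_cop_injM y h : D (inj y * h) = mulHH (t2 (inj y) 1 + t2 1 (inj y)) (D h).
Proof. by rewrite ue_copM ue_cop_inj. Qed.

Lemma ue_SS h : S (S h) = h.
Proof.
elim/(@ue_ind _ _ H): h => [|k x y hx hy|y h hh]; first by rewrite !ue_S1.
  by rewrite !linearP hx hy.
by rewrite !ue_SM ue_S_inj linearN ue_S_inj opprK hh.
Qed.

Lemma ue_eps_S h : eps (S h) = eps h.
Proof.
elim/(@ue_ind _ _ H): h => [|k x y hx hy|y h hh]; first by rewrite ue_S1.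
  by rewrite !linearP hx hy.
by rewrite ue_SM !ue_epsM ue_S_inj linearN ue_eps_inj oppr0 mulr0 mul0r.
Qed.

(** * Counits and antipode contractions on $H\otimes H$ *)

Lemma epsl_bil : is_bilinear (fun a b : H => eps a *: b).
Proof.
split=> [b k a a'|a k b b']; first by rewrite linearP scalerDl scalerA.
by rewrite scalerDr !scalerA mulrC.
Qed.

Lemma epsr_bil : is_bilinear (fun a b : H => eps b *: a).
Proof. by split=> [b|a]; [apply: epsl_bil.2|apply: epsl_bil.1]. Qed.

Definition epsl : {linear HH -> H} := blift epsl_bil.
Definition epsr : {linear HH -> H} := blift epsr_bil.

Lemma epsl_pure a b : epsl (t2 a b) = eps a *: b.
Proof. exact: blift_pure. Qed.

Lemma epsr_pure a b : epsr (t2 a b) = eps b *: a.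
Proof. exact: blift_pure. Qed.

Lemma epslM x y : epsl (mulHH x y) = epsl x * epsl y.
Proof.
elim/tensor_ind: x => [|x x' hx hx'|a b].
- by rewrite mulHH0l linear0 mul0r.
- by rewrite mulHHDl !linearD mulrDl hx hx'.
elim/tensor_ind: y => [|y y' hy hy'|c d].
- by rewrite mulHH0r linear0 mulr0.
- by rewrite mulHHDr !linearD mulrDr hy hy'.
by rewrite mulHH_pure !epsl_pure ue_epsM -scalerAl -scalerAr scalerA.
Qed.

Lemma epsrM x y : epsr (mulHH x y) = epsr x * epsr y.
Proof.
elim/tensor_ind: x => [|x x' hx hx'|a b].
- by rewrite mulHH0l linear0 mul0r.
- by rewrite mulHHDl !linearD mulrDl hx hx'.
elim/tensor_ind: y => [|y y' hy hy'|c d].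
- by rewrite mulHH0r linear0 mulr0.
- by rewrite mulHHDr !linearD mulrDr hy hy'.
by rewrite mulHH_pure !epsr_pure ue_epsM -scalerAl -scalerAr scalerA.
Qed.

Lemma epsl_cop h : epsl (D h) = h.
Proof.
elim/(@ue_ind _ _ H): h => [|k x y hx hy|y h hh].
- by rewrite ue_cop1 epsl_pure ue_eps1 scale1r.
- by rewrite !linearP hx hy.
rewrite ue_cop_injM epslM hh linearD !epsl_pure ue_eps_inj ue_eps1.
by rewrite scale0r add0r scale1r.
Qed.

Lemma epsr_cop h : epsr (D h) = h.
Proof.
elim/(@ue_ind _ _ H): h => [|k x y hx hy|y h hh].
- by rewrite ue_cop1 epsr_pure ue_eps1 scale1r.
- by rewrite !linearP hx hy.
rewrite ue_cop_injM epsrM hh linearD !epsr_pure ue_eps_inj ue_eps1.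
by rewrite scale0r addr0 scale1r.
Qed.

Lemma eps_epsr x : eps (epsr x) = eps (epsl x).
Proof.
elim/tensor_ind: x => [|x x' hx hx'|a b]; first by rewrite !linear0.
  by rewrite !linearD hx hx'.
by rewrite epsl_pure epsr_pure !linearZ /= mulrC.
Qed.

Lemma aS_bil : is_bilinear (fun a b : H => b * S a).
Proof.
split=> [b k a a'|a k b b']; first by rewrite linearP mulrDr scalerAr.
by rewrite mulrDl scalerAl.
Qed.

(** On $\Delta(h)$ this is $h_{(2)}S(h_{(1)})$, with the slots opposite to the usual antipode axiom;
    it still equals $\varepsilon(h)$ because $H$ is cocommutative. *)
Definition aS : {linear HH -> H} := blift aS_bil.

Lemma aS_pure a b : aS (t2 a b) = b * S a.
Proof. exact: blift_pure. Qed.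

Lemma bS_bil x : is_bilinear (fun a b : H => S b * x * a).
Proof.
split=> [b k a a'|a k b b']; first by rewrite mulrDr scalerAr.
by rewrite linearP !mulrDl !scalerAl.
Qed.

Definition bS x : {linear HH -> H} := blift (bS_bil x).

Lemma bS_pure x a b : bS x (t2 a b) = S b * x * a.
Proof. exact: blift_pure. Qed.

Lemma bS_cop h : bS 1 (D h) = eps h *: 1.
Proof.
elim/(@ue_ind _ _ H): h => [|k x y hx hy|y h hh].
- by rewrite ue_cop1 bS_pure ue_S1 ue_eps1 !mulr1 scale1r.
- by rewrite !linearP hx hy scalerDl scalerA.
(* The two summands of $\Delta(y)$ give $S(b)ya$ and $S(b)S(y)a=-S(b)ya$, which cancel. *)
have bSy x : bS 1 (mulHH (t2 (inj y) 1 + t2 1 (inj y)) x) = 0.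
  elim/tensor_ind: x => [|x x' hx hx'|a b].
  - by rewrite mulHH0r linear0.
  - by rewrite mulHHDr !linearD hx hx' addr0.
  rewrite mulHHDl linearD !mulHH_pure !bS_pure !mul1r ue_SM ue_S_inj.
  by rewrite !mulr1 !mulrN !mulNr !mulrA subrr.
by rewrite ue_cop_injM bSy ue_epsM ue_eps_inj mul0r scale0r.
Qed.

Lemma aS_cop h : aS (D h) = eps h *: 1.
Proof.
elim/(@ue_ind _ _ H): h => [|k x y hx hy|y h hh].
- by rewrite ue_cop1 aS_pure ue_S1 ue_eps1 mulr1 scale1r.
- by rewrite !linearP hx hy scalerDl scalerA.
(* A generator acts by a commutator, which vanishes on the scalar [aS (D h)] supplied by
   induction. *)
have aSy x : aS (mulHH (t2 (inj y) 1 + t2 1 (inj y)) x) =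
    inj y * aS x - aS x * inj y.
  elim/tensor_ind: x => [|x x' hx hx'|a b].
  - by rewrite mulHH0r linear0 mulr0 mul0r subr0.
  - by rewrite mulHHDr !linearD hx hx' mulrDr mulrDl opprD addrACA.
  rewrite mulHHDl linearD !mulHH_pure !aS_pure !mul1r ue_SM ue_S_inj.
  by rewrite !mulrN !mulrA addrC.
rewrite ue_cop_injM aSy hh ue_epsM ue_eps_inj mul0r scale0r.
by rewrite -scalerAl -scalerAr mulr1 mul1r subrr.
Qed.

(** The inner factor $h_{(2)}S(h_{(1)})$ collapses to $\varepsilon(h)$. This makes [theta] and
    [unspan] balanced, since they pair [aS] with a map that also turns the action of $h$ into
    $\varepsilon(h)$. *)
Lemma aSM_cop x h : aS (mulHH x (D h)) = eps h *: aS x.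
Proof.
elim/tensor_ind: x => [|x x' hx hx'|a b].
- by rewrite mulHH0l linear0 scaler0.
- by rewrite mulHHDl !linearD hx hx'.
have aSM z : aS (mulHH (t2 a b) z) = b * aS z * S a.
  elim/tensor_ind: z => [|z z' hz hz'|c d].
  - by rewrite mulHH0r linear0 mulr0 mul0r.
  - by rewrite mulHHDr !linearD mulrDr mulrDl hz hz'.
  by rewrite mulHH_pure !aS_pure ue_SM !mulrA.
by rewrite aSM aS_cop -scalerAr mulr1 -scalerAl aS_pure.
Qed.

(** * Operators on $H^{\otimes 3}$: counits of the slots, $\Delta\otimes\mathrm{id}$,
    $\mathrm{id}\otimes\Delta$, and the contraction [tau] *)

Lemma eps3_bil : is_bilinear (fun (u : HH) (c : H) => eps c *: u).
Proof.
split=> [c k u u'|u k c c']; first by rewrite scalerDr !scalerA mulrC.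
by rewrite linearP scalerDl scalerA.
Qed.

Lemma eps2_bil : is_bilinear (fun (u : HH) (c : H) => t2 (epsr u) c).
Proof.
split=> [c k u u'|u k c c']; first by rewrite linearP tprodDl tprodZl.
by rewrite tprodDr tprodZr.
Qed.

Lemma eps1_bil : is_bilinear (fun (u : HH) (c : H) => t2 (epsl u) c).
Proof.
split=> [c k u u'|u k c c']; first by rewrite linearP tprodDl tprodZl.
by rewrite tprodDr tprodZr.
Qed.

Definition eps1 : {linear HHH -> HH} := blift eps1_bil.
Definition eps2 : {linear HHH -> HH} := blift eps2_bil.
Definition eps3 : {linear HHH -> HH} := blift eps3_bil.

Lemma eps1_pure u c : eps1 (tprod u c) = t2 (epsl u) c.
Proof. exact: blift_pure. Qed.

Lemma eps2_pure u c : eps2 (tprod u c) = t2 (epsr u) c.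
Proof. exact: blift_pure. Qed.

Lemma eps3_pure u c : eps3 (tprod u c) = eps c *: u.
Proof. exact: blift_pure. Qed.

Lemma eps1M (x y : HHH) : eps1 (mulHHH x y) = mulHH (eps1 x) (eps1 y).
Proof.
elim/tensor_ind: x => [|x x' hx hx'|a b].
- by rewrite mulHHH0l linear0 mulHH0l.
- by rewrite mulHHHDl !linearD mulHHDl hx hx'.
elim/tensor_ind: y => [|y y' hy hy'|c d].
- by rewrite mulHHH0r linear0 mulHH0r.
- by rewrite mulHHHDr !linearD mulHHDr hy hy'.
by rewrite mulHHH_pure !eps1_pure epslM mulHH_pure.
Qed.

Lemma eps2M (x y : HHH) : eps2 (mulHHH x y) = mulHH (eps2 x) (eps2 y).
Proof.
elim/tensor_ind: x => [|x x' hx hx'|a b].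
- by rewrite mulHHH0l linear0 mulHH0l.
- by rewrite mulHHHDl !linearD mulHHDl hx hx'.
elim/tensor_ind: y => [|y y' hy hy'|c d].
- by rewrite mulHHH0r linear0 mulHH0r.
- by rewrite mulHHHDr !linearD mulHHDr hy hy'.
by rewrite mulHHH_pure !eps2_pure epsrM mulHH_pure.
Qed.

Lemma eps3M (x y : HHH) : eps3 (mulHHH x y) = mulHH (eps3 x) (eps3 y).
Proof.
elim/tensor_ind: x => [|x x' hx hx'|a b].
- by rewrite mulHHH0l linear0 mulHH0l.
- by rewrite mulHHHDl !linearD mulHHDl hx hx'.
elim/tensor_ind: y => [|y y' hy hy'|c d].
- by rewrite mulHHH0r linear0 mulHH0r.
- by rewrite mulHHHDr !linearD mulHHDr hy hy'.
rewrite mulHHH_pure !eps3_pure ue_epsM (bilinZl mulHH_bilinear).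
by rewrite (bilinZr mulHH_bilinear) scalerA.
Qed.

Lemma copl_bil : is_bilinear (fun f h : H => tprod (D f) h : HHH).
Proof.
split=> [h k f f'|f k h h']; first by rewrite linearP tprodDl tprodZl.
by rewrite tprodDr tprodZr.
Qed.

Definition coplL : {linear HH -> HHH} := mk_linear (tensor_lift_lin copl_bil).

Lemma coplE x : copl x = coplL x.
Proof. by []. Qed.

Lemma copl_pure f h : coplL (t2 f h) = tprod (D f) h.
Proof. exact: (tensor_lift_pure copl_bil). Qed.

Lemma injr_bil : is_bilinear (fun f h : H => t3 1 f h).
Proof.
split=> [h k f f'|f k h h']; first by rewrite tprodDr tprodZr tprodDl tprodZl.
by rewrite tprodDr tprodZr.
Qed.

Definition injrL : {linear HH -> HHH} := mk_linear (tensor_lift_lin injr_bil).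

Lemma injrE x : injr x = injrL x.
Proof. by []. Qed.

Lemma injr_pure f h : injrL (t2 f h) = t3 1 f h.
Proof. exact: (tensor_lift_pure injr_bil). Qed.

Lemma asc_bil f : is_bilinear (fun h1 h2 : H => t3 f h1 h2).
Proof.
split=> [h k a a'|h k a a']; first by rewrite tprodDr tprodZr tprodDl tprodZl.
by rewrite tprodDr tprodZr.
Qed.

Definition asc f : {linear HH -> HHH} := blift (asc_bil f).

Lemma asc_pure f a b : asc f (t2 a b) = t3 f a b.
Proof. exact: blift_pure. Qed.

Lemma copr_bil : is_bilinear (fun f h : H => asc f (D h)).
Proof.
split=> [h|f]; last by move=> k h h'; rewrite !linearP.
move=> k f f'; elim/tensor_ind: (D h) => [|x y hx hy|a b].
- by rewrite !linear0 addr0.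
- by rewrite !linearD hx hy addrACA.
by rewrite !asc_pure !(tprodDl, tprodZl).
Qed.

Definition coprL : {linear HH -> HHH} := mk_linear (tensor_lift_lin copr_bil).

Lemma coprE x : copr x = coprL x.
Proof. by []. Qed.

Lemma copr_pure f h : coprL (t2 f h) = asc f (D h).
Proof. exact: (tensor_lift_pure copr_bil). Qed.

Lemma coplM (x y : HH) : coplL (mulHH x y) = mulHHH (coplL x) (coplL y).
Proof.
elim/tensor_ind: x => [|x x' hx hx'|a b].
- by rewrite mulHH0l linear0 mulHHH0l.
- by rewrite mulHHDl !linearD mulHHHDl hx hx'.
elim/tensor_ind: y => [|y y' hy hy'|c d].
- by rewrite mulHH0r linear0 mulHHH0r.
- by rewrite mulHHDr !linearD mulHHHDr hy hy'.
by rewrite mulHH_pure !copl_pure mulHHH_pure ue_copM.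
Qed.

Lemma eps1_copl (x : HH) : eps1 (coplL x) = x.
Proof.
elim/tensor_ind: x => [|x x' hx hx'|a b]; first by rewrite !linear0.
  by rewrite !linearD hx hx'.
by rewrite copl_pure eps1_pure epsl_cop.
Qed.

Lemma eps2_copl (x : HH) : eps2 (coplL x) = x.
Proof.
elim/tensor_ind: x => [|x x' hx hx'|a b]; first by rewrite !linear0.
  by rewrite !linearD hx hx'.
by rewrite copl_pure eps2_pure epsr_cop.
Qed.

Lemma eps3_copl (x : HH) : eps3 (coplL x) = D (epsr x).
Proof.
elim/tensor_ind: x => [|x x' hx hx'|a b]; first by rewrite !linear0.
  by rewrite !linearD hx hx'.
by rewrite copl_pure eps3_pure epsr_pure linearZZ.
Qed.

Lemma eps1_copr (x : HH) : eps1 (coprL x) = D (epsl x).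
Proof.
elim/tensor_ind: x => [|x x' hx hx'|a b]; first by rewrite !linear0.
  by rewrite !linearD hx hx'.
rewrite copr_pure epsl_pure linearZZ.
elim/tensor_ind: (D b) => [|x x' hx hx'|c d].
- by rewrite !linear0.
- by rewrite !linearD hx hx'.
by rewrite asc_pure eps1_pure epsl_pure tprodZl.
Qed.

Lemma eps2_copr (x : HH) : eps2 (coprL x) = x.
Proof.
elim/tensor_ind: x => [|x x' hx hx'|a b]; first by rewrite !linear0.
  by rewrite !linearD hx hx'.
rewrite copr_pure -[b in RHS]epsl_cop.
elim/tensor_ind: (D b) => [|x x' hx hx'|c d].
- by rewrite !linear0 (bilin0r (tprod_bilinear _ _)).
- by rewrite !linearD hx hx' tprodDr.
by rewrite asc_pure eps2_pure epsl_pure epsr_pure tprodZl tprodZr.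
Qed.

Lemma eps3_copr (x : HH) : eps3 (coprL x) = x.
Proof.
elim/tensor_ind: x => [|x x' hx hx'|a b]; first by rewrite !linear0.
  by rewrite !linearD hx hx'.
rewrite copr_pure -[b in RHS]epsr_cop.
elim/tensor_ind: (D b) => [|x x' hx hx'|c d].
- by rewrite !linear0 (bilin0r (tprod_bilinear _ _)).
- by rewrite !linearD hx hx' tprodDr.
by rewrite asc_pure eps3_pure epsr_pure tprodZr.
Qed.

Lemma eps1_injl (x : HH) : eps1 (injl x) = t2 (epsl x) 1.
Proof. exact: eps1_pure. Qed.

Lemma eps2_injl (x : HH) : eps2 (injl x) = t2 (epsr x) 1.
Proof. exact: eps2_pure. Qed.

Lemma eps3_injl (x : HH) : eps3 (injl x) = x.
Proof. by rewrite /injl eps3_pure ue_eps1 scale1r. Qed.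

Lemma eps1_injr (x : HH) : eps1 (injrL x) = x.
Proof.
elim/tensor_ind: x => [|x x' hx hx'|a b]; first by rewrite !linear0.
  by rewrite !linearD hx hx'.
by rewrite injr_pure eps1_pure epsl_pure ue_eps1 scale1r.
Qed.

Lemma eps2_injr (x : HH) : eps2 (injrL x) = t2 1 (epsl x).
Proof.
elim/tensor_ind: x => [|x x' hx hx'|a b].
- by rewrite !linear0 (bilin0r (tprod_bilinear _ _)).
- by rewrite !linearD hx hx' tprodDr.
by rewrite injr_pure eps2_pure epsr_pure epsl_pure tprodZl tprodZr.
Qed.

Lemma eps3_injr (x : HH) : eps3 (injrL x) = t2 1 (epsr x).
Proof.
elim/tensor_ind: x => [|x x' hx hx'|a b].
- by rewrite !linear0 (bilin0r (tprod_bilinear _ _)).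
- by rewrite !linearD hx hx' tprodDr.
by rewrite injr_pure eps3_pure epsr_pure tprodZr.
Qed.

Lemma eps1_cop3 h : eps1 (cop3 h) = D h.
Proof. exact: eps1_copl. Qed.

Lemma eps2_cop3 h : eps2 (cop3 h) = D h.
Proof. exact: eps2_copl. Qed.

Lemma eps3_cop3 h : eps3 (cop3 h) = D h.
Proof. by rewrite /cop3 coplE eps3_copl epsr_cop. Qed.

(* At [x = 1] this descends to a map [H^(3) (x)_H V -> V], as                  *)
(* [k_3 S(k_2) x k_1 = x k] in a cocommutative Hopf algebra ([tau_cop3]).       *)
Lemma tau_bil x : is_bilinear (fun (u : HH) (c : H) => c * bS x u).
Proof.
split=> [c k u u'|u k c c']; first by rewrite linearP mulrDr scalerAr.
by rewrite mulrDl scalerAl.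
Qed.

Definition tau x : {linear HHH -> H} := blift (tau_bil x).

Lemma tau_pure x u c : tau x (tprod u c) = c * bS x u.
Proof. exact: blift_pure. Qed.

(** The parameter of [tau] exists to absorb the left factors $a$ and $b$, which end up in the middle
    of the product. *)
Lemma tauM x a b c (z : HHH) :
  tau x (mulHHH (t3 a b c) z) = c * tau (S b * x * a) z.
Proof.
elim/HHH_ind: z => [|z z' hz hz'|a' b' c'].
- by rewrite mulHHH0r !linear0 mulr0.
- by rewrite mulHHHDr !linearD hz hz' mulrDr.
by rewrite mulHHH_pure mulHH_pure !tau_pure !bS_pure ue_SM !mulrA.
Qed.

(** Induction on $h$ with $x$ general: for $yh$ the three slots contribute $xyh$, $-yxh$ and $yxh$,
    whose sum is $x(yh)$. *)
Lemma tau_cop3 x h : tau x (cop3 h) = x * h.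
Proof.
elim/(@ue_ind _ _ H): h x => [|k a b ha hb|y h hh] x.
- by rewrite /cop3 coplE ue_cop1 copl_pure ue_cop1 tau_pure bS_pure ue_S1 !mul1r mulr1.
- have -> : cop3 (k *: a + b) = k *: cop3 a + cop3 b.
    by rewrite /cop3 !coplE !linearP.
  by rewrite linearP ha hb mulrDr scalerAr.
rewrite /cop3 ue_copM coplE coplM ue_cop_inj linearD !copl_pure -/(cop3 h).
rewrite ue_cop_inj ue_cop1 tprodDl !mulHHHDl !linearD !tauM !hh.
by rewrite ue_S1 ue_S_inj !mul1r !mulr1 !mulNr !mulrA subrK.
Qed.

Lemma tauM_cop3 (z : HHH) (h : H) : tau 1 (mulHHH z (cop3 h)) = tau 1 z * h.
Proof.
elim/HHH_ind: z => [|z z' hz hz'|a b c].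
- by rewrite mulHHH0l linear0 mul0r.
- by rewrite mulHHHDl !linearD mulrDl hz hz'.
by rewrite tauM tau_cop3 tau_pure bS_pure !mulr1 !mulrA.
Qed.

Lemma tau_copl (x : HH) : tau 1 (coplL x) = epsl x.
Proof.
elim/tensor_ind: x => [|x x' hx hx'|a b]; first by rewrite !linear0.
  by rewrite !linearD hx hx'.
by rewrite copl_pure tau_pure bS_cop epsl_pure -scalerAr mulr1.
Qed.

(** For $x=a\otimes b$ and $y=c\otimes d$ the value is
    $b\,d_{(2)}S(d_{(1)})S(a)c=\varepsilon(d)\,bS(a)c$. *)
Lemma tau_injr_copr (x y : HH) : tau 1 (mulHHH (injrL x) (coprL y)) = aS x * epsr y.
Proof.
elim/tensor_ind: x => [|x x' hx hx'|a b].
- by rewrite !linear0 mulHHH0l linear0 mul0r.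
- by rewrite !linearD mulHHHDl !linearD mulrDl hx hx'.
elim/tensor_ind: y => [|y y' hy hy'|c d].
- by rewrite !linear0 mulHHH0r linear0 mulr0.
- by rewrite !linearD mulHHHDr !linearD mulrDr hy hy'.
rewrite injr_pure copr_pure aS_pure epsr_pure.
have tauE (z : HH) : tau 1 (mulHHH (t3 1 a b) (asc c z)) = b * aS z * S a * c.
  rewrite tauM; elim/tensor_ind: z => [|z z' hz hz'|a' b'].
  - by rewrite !linear0 mulr0 !mul0r.
  - rewrite (linearD (asc c)) (linearD (tau _)) (linearD aS) mulrDr hz hz'.
    by rewrite [in RHS]mulrDr !mulrDl.
  by rewrite asc_pure tau_pure bS_pure aS_pure !mulr1 !mulrA.
by rewrite tauE aS_cop -scalerAr mulr1 -scalerAr -!scalerAl.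
Qed.

(** * Straightening $H\otimes H$ as a right $H$-module *)

Lemma twist_bil : is_bilinear (fun a b : H => mulHH (D b) (t2 (S a) 1)).
Proof.
split=> [b k a a'|a k b b'].
  by rewrite linearP tprodDl tprodZl mulHHDr (bilinZr mulHH_bilinear).
by rewrite linearP mulHHDl (bilinZl mulHH_bilinear).
Qed.

(** A change of variables after which right multiplication by $\Delta(h)$ becomes right
    multiplication by $1\otimes h$ ([twistM_cop]); tensoring over $H$ then removes the second
    factor. *)
Definition twist : {linear HH -> HH} := blift twist_bil.

Lemma twist_pure a b : twist (t2 a b) = mulHH (D b) (t2 (S a) 1).
Proof. exact: blift_pure. Qed.

Lemma twist_cop h : twist (D h) = t2 1 h.
Proof.
elim/(@ue_ind _ _ H): h => [|k x y hx hy|y h hh].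
- by rewrite ue_cop1 twist_pure ue_cop1 ue_S1 mul1HH.
- by rewrite !linearP hx hy tprodDr tprodZr.
pose u := t2 (inj y) 1 + t2 1 (inj y).
(* The slot $y\otimes 1$ enters through $S$ on the far right with a minus sign. Against $1\otimes h$
   it cancels the summand $y\otimes h$ of the first term and leaves $1\otimes yh$. *)
have twy (x : HH) :
    twist (mulHH u x) = mulHH u (twist x) - mulHH (twist x) (t2 (inj y) 1).
  elim/tensor_ind: x => [|x x' hx hx'|a b].
  - by rewrite !mulHH0r linear0 mulHH0l !mulHH0r subr0.
  - rewrite mulHHDr !(linearD twist) mulHHDr [X in _ - X]mulHHDl hx hx'.
    by rewrite opprD addrACA.
  rewrite [in LHS]/u [in LHS]mulHHDl [in LHS]linearD !mulHH_pure !twist_pure !mul1r.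
  rewrite ue_copM ue_cop_inj ue_SM ue_S_inj addrC -!mulHHA !mulHH_pure.
  congr (_ + _); rewrite mulrN tprodNl mulr1 -scaleN1r.
  by rewrite (bilinZr mulHH_bilinear) scaleN1r.
rewrite ue_cop_injM -/u twy hh /u mulHHDl !mulHH_pure !mulr1 !mul1r.
by rewrite addrAC subrr add0r.
Qed.

Lemma twistM_cop (x : HH) (h : H) : twist (mulHH x (D h)) = mulHH (twist x) (t2 1 h).
Proof.
elim/tensor_ind: x => [|x x' hx hx'|a b].
- by rewrite mulHH0l linear0 mulHH0l.
- by rewrite mulHHDl !linearD mulHHDl hx hx'.
have twM (z : HH) : twist (mulHH (t2 a b) z) = mulHH (mulHH (D b) (twist z)) (t2 (S a) 1).
  elim/tensor_ind: z => [|z z' hz hz'|c d].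
  - by rewrite mulHH0r linear0 mulHH0r mulHH0l.
  - by rewrite mulHHDr !linearD mulHHDr mulHHDl hz hz'.
  by rewrite mulHH_pure !twist_pure ue_SM ue_copM -!mulHHA !mulHH_pure mulr1.
by rewrite twM twist_cop twist_pure -!mulHHA !mulHH_pure !mulr1 !mul1r.
Qed.

Lemma untwist_bil : is_bilinear (fun a b : H => mulHH (t2 (S a) 1) (D b)).
Proof.
split=> [b k a a'|a k b b'].
  by rewrite linearP tprodDl tprodZl mulHHDl (bilinZl mulHH_bilinear).
by rewrite linearP mulHHDr (bilinZr mulHH_bilinear).
Qed.

Definition untwist : {linear HH -> HH} := blift untwist_bil.

Lemma untwist_pure a b : untwist (t2 a b) = mulHH (t2 (S a) 1) (D b).
Proof. exact: blift_pure. Qed.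

Lemma untwist_cop h : untwist (D h) = t2 1 h.
Proof.
elim/(@ue_ind _ _ H): h => [|k x y hx hy|y h hh].
- by rewrite ue_cop1 untwist_pure ue_cop1 ue_S1 mul1HH.
- by rewrite !linearP hx hy tprodDr tprodZr.
(* Here $S(ya)=-S(a)y$ cancels the $y\otimes 1$ part of $\Delta(yb)=\Delta(y)\Delta(b)$. *)
have uny (x : HH) : untwist (mulHH (t2 (inj y) 1 + t2 1 (inj y)) x) =
    mulHH (t2 1 (inj y)) (untwist x).
  elim/tensor_ind: x => [|x x' hx hx'|a b].
  - by rewrite !mulHH0r linear0 mulHH0r.
  - by rewrite mulHHDr !linearD hx hx' mulHHDr.
  rewrite mulHHDl linearD !mulHH_pure !untwist_pure !mul1r.
  rewrite ue_copM ue_cop_inj ue_SM ue_S_inj !mulHHA mulHHDr !mulHH_pure.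
  rewrite mulrN !mulr1 !mul1r -mulHHDl addrA -tprodDl addNr.
  by rewrite (bilin0l (tprod_bilinear _ _)) add0r.
by rewrite ue_cop_injM uny hh mulHH_pure mul1r.
Qed.

Lemma twistK (x : HH) : untwist (twist x) = x.
Proof.
elim/tensor_ind: x => [|x x' hx hx'|a b]; first by rewrite !linear0.
  by rewrite !linearD hx hx'.
have unM (z : HH) : untwist (mulHH z (t2 (S a) 1)) = mulHH (t2 a 1) (untwist z).
  elim/tensor_ind: z => [|z z' hz hz'|c d].
  - by rewrite mulHH0l linear0 mulHH0r.
  - by rewrite mulHHDl !linearD mulHHDr hz hz'.
  by rewrite mulHH_pure !untwist_pure ue_SM ue_SS mulHHA mulHH_pure !mulr1.
by rewrite twist_pure unM untwist_cop mulHH_pure mulr1 mul1r.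
Qed.

End Hopf.

Arguments epsl {K g H}.
Arguments epsr {K g H}.
Arguments aS {K g H}.
Arguments eps1 {K g H}.
Arguments eps2 {K g H}.
Arguments eps3 {K g H}.
Arguments coplL {K g H}.
Arguments coprL {K g H}.
Arguments injrL {K g H}.
Arguments twist {K g H}.
Arguments untwist {K g H}.

(** * Pseudotensors and associativity *)

Section HModules.
Variables (K : fieldType) (g : lie_algebra K) (H : enveloping g).

Local Notation HH := (HH H).
Local Notation HHH := (HHH H).
Local Notation D := (ue_cop H).
Local Notation eps := (ue_eps H).
Local Notation S := (ue_S H).
Local Notation t2 a b := (tprod (a : H) (b : H) : HH) (only parsing).

Lemma mulHHHA : associative (@mulHHH K g H).
Proof.
move=> x y z; elim/tensor_ind: x => [|x x' hx hx'|a b].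
- by rewrite !mulHHH0l.
- by rewrite !mulHHHDl hx hx'.
elim/tensor_ind: y => [|y y' hy hy'|c d].
- by rewrite mulHHH0l mulHHH0r mulHHH0l.
- by rewrite mulHHHDl mulHHHDr hy hy' mulHHHDr mulHHHDl.
elim/tensor_ind: z => [|z z' hz hz'|e f].
- by rewrite !mulHHH0r.
- by rewrite !mulHHHDr hz hz'.
by rewrite !mulHHH_pure mulHHA mulrA.
Qed.

Section Eval.
Variables (U : lmodType K) (x : dual H).

Lemma xeval_bil : is_bilinear (fun (h : H) (u : U) => x h *: u).
Proof.
split=> [v k h h'|h k v v']; first by rewrite dualP scalerDl scalerA.
by rewrite scalerDr !scalerA mulrC.
Qed.

Definition xeval : {linear tensor H U -> U} := blift xeval_bil.

Lemma xeval_pure h u : xeval (tprod h u) = x h *: u.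
Proof. exact: blift_pure. Qed.

End Eval.

Section One.
Variable V : hmodule H.
Implicit Types (v : V) (al : tens2 V) (x : dual H).

Definition hactDl (h h' : H) v := bilinDl (hact_bilinear V) h h' v.
Definition hactDr (h : H) v v' := bilinDr (hact_bilinear V) h v v'.
Definition hactZl k (h : H) v := bilinZl (hact_bilinear V) k h v.
Definition hactZr k (h : H) v := bilinZr (hact_bilinear V) k h v.
Definition hact0l v := bilin0l (hact_bilinear V) v.
Definition hact0r (h : H) := bilin0r (hact_bilinear V) h.
Definition hact_suml I (s : seq I) F v := bilin_suml (hact_bilinear V) s F v.

Lemma tp2_bal (be : HH) (h : H) v : tp2 (mulHH be (D h)) v = tp2 be (hact h v).
Proof. exact: tpure_bal. Qed.

Lemma tp3_bal (be : HHH) (h : H) v :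
  tp3 (mulHHH be (cop3 h)) v = tp3 be (hact h v).
Proof. exact: tpure_bal. Qed.

Lemma tp2_bilinear : is_bilinear (@tp2 K g H V).
Proof. exact: tpure_bilinear. Qed.

Lemma tp3_bilinear : is_bilinear (@tp3 K g H V).
Proof. exact: tpure_bilinear. Qed.

Lemma tens2_ind (P : tens2 V -> Prop) :
  P 0 -> (forall a b, P a -> P b -> P (a + b)) ->
  (forall be v, P (tp2 be v)) -> forall al, P al.
Proof. exact: tens_ind. Qed.

Lemma tens2_reprE al : \sum_(p <- repr al) tp2 p.1 p.2 = al.
Proof. exact: tens_reprE. Qed.

Section HactLift.
Variable F : {linear HH -> H}.
Hypothesis FM : forall be h, F (mulHH be (D h)) = F be * h.

Lemma hact_lift_bil : is_bilinear (fun (be : HH) (v : V) => hact (F be) v).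
Proof.
split=> [v k b b'|b k v v']; first by rewrite linearP hactDl hactZl.
by rewrite hactDr hactZr.
Qed.

Lemma hact_lift_bal be h v : hact (F (mulHH be (D h))) v = hact (F be) (hact h v).
Proof. by rewrite FM hactM. Qed.

Definition hact_lift : {linear tens2 V -> V} :=
  balift hact_lift_bil hact_lift_bal.

Lemma hact_lift_pure be v : hact_lift (tp2 be v) = hact (F be) v.
Proof. exact: (balift_pure hact_lift_bil hact_lift_bal). Qed.

End HactLift.

Lemma epsrM_cop (be : HH) (h : H) : epsr (mulHH be (D h)) = epsr be * h.
Proof. by rewrite epsrM epsr_cop. Qed.

Lemma epslM_cop (be : HH) (h : H) : epsl (mulHH be (D h)) = epsl be * h.
Proof. by rewrite epslM epsl_cop. Qed.

(** [mu] and [nu] of the pseudoproduct $a*v$ are the products $a.v$ and $a\circ v$ of the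
    introduction. *)
Definition mu : {linear tens2 V -> V} := hact_lift epsrM_cop.
Definition nu : {linear tens2 V -> V} := hact_lift epslM_cop.

Lemma mu_pure be v : mu (tp2 be v) = hact (epsr be) v.
Proof. exact: hact_lift_pure. Qed.

Lemma nu_pure be v : nu (tp2 be v) = hact (epsl be) v.
Proof. exact: hact_lift_pure. Qed.

Lemma lact2_bil (ga : HH) :
  is_bilinear (fun (be : HH) (v : V) => tp2 (mulHH ga be) v).
Proof.
split=> [v k b b'|b k v v']; last exact: tp2_bilinear.2.
by rewrite (mulHH_bilinear H).2 tp2_bilinear.1.
Qed.

Lemma lact2_bal (ga be : HH) (h : H) v :
  tp2 (mulHH ga (mulHH be (D h))) v = tp2 (mulHH ga be) (hact h v).
Proof. by rewrite mulHHA tp2_bal. Qed.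

Definition lact2L (ga : HH) : {linear tens2 V -> tens2 V} :=
  balift (lact2_bil ga) (lact2_bal ga).

Lemma lact2E ga al : lact2 ga al = lact2L ga al.
Proof. by []. Qed.

Lemma lact2L_pure ga be v : lact2L ga (tp2 be v) = tp2 (mulHH ga be) v.
Proof. exact: (balift_pure (lact2_bil ga) (lact2_bal ga)). Qed.

Lemma mu_lact2 (ga : HH) al : mu (lact2L ga al) = hact (epsr ga) (mu al).
Proof.
elim/tens2_ind: al => [|x y hx hy|be v]; first by rewrite !linear0 hact0r.
  by rewrite !linearD hactDr hx hy.
by rewrite lact2L_pure !mu_pure epsrM hactM.
Qed.

Lemma nu_lact2 (ga : HH) al : nu (lact2L ga al) = hact (epsl ga) (nu al).
Proof.
elim/tens2_ind: al => [|x y hx hy|be v]; first by rewrite !linear0 hact0r.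
  by rewrite !linearD hactDr hx hy.
by rewrite lact2L_pure !nu_pure epslM hactM.
Qed.

(* The isomorphism onto [H (x) V] sending [(f (x) 1) (x)_H v] to [S f (x) v]. *)
Lemma act2_bil v : is_bilinear (fun a b : H => tprod a (hact b v) : tensor H V).
Proof.
split=> [b k a a'|a k b b']; first by rewrite tprodDl tprodZl.
by rewrite hactDl hactZl tprodDr tprodZr.
Qed.

Definition act2 v : {linear HH -> tensor H V} := blift (act2_bil v).

Lemma act2_pure v a b : act2 v (t2 a b) = tprod a (hact b v).
Proof. exact: blift_pure. Qed.

Lemma left_form_bil :
  is_bilinear (fun (be : HH) (v : V) => act2 v (twist be)).
Proof.
split=> [v k b b'|b k v v']; first by rewrite !linearP.
elim/tensor_ind: (twist b) => [|x y hx hy|a c].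
- by rewrite !linear0 addr0.
- by rewrite !linearD hx hy addrACA.
by rewrite !act2_pure hactDr hactZr tprodDr tprodZr.
Qed.

Lemma left_form_bal (be : HH) (h : H) v :
  act2 v (twist (mulHH be (D h))) = act2 (hact h v) (twist be).
Proof.
rewrite twistM_cop; elim/tensor_ind: (twist be) => [|x y hx hy|a c].
- by rewrite mulHH0l !linear0.
- by rewrite mulHHDl !linearD hx hy.
by rewrite mulHH_pure !act2_pure mulr1 hactM.
Qed.

Definition left_form : {linear tens2 V -> tensor H V} :=
  balift left_form_bil left_form_bal.

Lemma left_form_pure be v : left_form (tp2 be v) = act2 v (twist be).
Proof. exact: (balift_pure left_form_bil left_form_bal). Qed.

Lemma left_form1 f v : left_form (tp2 (t2 f 1) v) = tprod (S f) v.
Proof.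
by rewrite left_form_pure twist_pure ue_cop1 mul1HH act2_pure hact1.
Qed.

Lemma of_left_form_bil :
  is_bilinear (fun (h : H) (v : V) => tp2 (t2 (S h) 1) v).
Proof.
split=> [v k h h'|h k v v']; last exact: tp2_bilinear.2.
by rewrite linearP tprodDl tprodZl tp2_bilinear.1.
Qed.

Definition of_left_form : {linear tensor H V -> tens2 V} :=
  blift of_left_form_bil.

Lemma of_left_form_pure h v : of_left_form (tprod h v) = tp2 (t2 (S h) 1) v.
Proof. exact: blift_pure. Qed.

Lemma left_formK al : of_left_form (left_form al) = al.
Proof.
elim/tens2_ind: al => [|x y hx hy|be v]; first by rewrite !linear0.
  by rewrite !linearD hx hy.
rewrite left_form_pure -[in RHS](twistK be).
elim/tensor_ind: (twist be) => [|x y hx hy|a b].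
- by rewrite !linear0 (bilin0l tp2_bilinear).
- by rewrite !linearD hx hy (bilinDl tp2_bilinear).
by rewrite act2_pure of_left_form_pure untwist_pure tp2_bal.
Qed.

(** [left_form] takes every expression $\sum(f\otimes1)\otimes_Hv$ of [al] to the same $\sum
    S(f)\otimes v$, so the choice hidden in [xget] does not matter; [left_formK] shows that such an
    expression exists. *)
Lemma xcoefE x al : xcoef x al = xeval V x (left_form al).
Proof.
have xs (s : seq (H * V)) : xeval V x (left_form (\sum_(p <- s) tp2 (t2 p.1 1) p.2)) =
    \sum_(p <- s) x (S p.1) *: p.2.
  rewrite (linear_sum left_form) (linear_sum (xeval V x)).
  by apply: eq_bigr => p _; rewrite left_form1 xeval_pure.
rewrite /xcoef; apply: xget_unique => [|w [s [-> ->]]]; last by rewrite xs.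
have [s es] := tensor_sum (left_form al).
(* As $S$ is an involution, a term $f\otimes v$ of the left form comes from $(S(f)\otimes
   1)\otimes_H v$. *)
exists [seq (S p.1, p.2) | p <- s].
have e : al = \sum_(p <- [seq (S p.1, p.2) | p <- s]) tp2 (t2 p.1 1) p.2.
  rewrite big_map /= -[LHS]left_formK es (linear_sum of_left_form).
  by apply: eq_bigr => p _; rewrite of_left_form_pure.
by split=> //; rewrite -xs -e.
Qed.

Lemma xcoef_counit al : xcoef (counit H) al = nu al.
Proof.
rewrite xcoefE; elim/tens2_ind: al => [|x y hx hy|be v].
- by rewrite !linear0.
- by rewrite !linearD hx hy.
rewrite left_form_pure nu_pure.
elim/tensor_ind: be => [|x y hx hy|a b].
- by rewrite !linear0 hact0l.
- by rewrite !linearD hactDl hx hy.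
rewrite twist_pure epsl_pure.
have e (z : HH) : xeval V (counit H) (act2 v (mulHH z (t2 (S a) 1))) =
    eps a *: hact (epsl z) v.
  elim/tensor_ind: z => [|x y hx hy|c d].
  - by rewrite mulHH0l !linear0 hact0l scaler0.
  - by rewrite mulHHDl !linearD hactDl scalerDr hx hy.
  rewrite mulHH_pure act2_pure xeval_pure epsl_pure mulr1 hactZl scalerA.
  have cE h : counit H h = eps h by [].
  by rewrite cE ue_epsM ue_eps_S mulrC.
by rewrite e epsl_cop hactZl.
Qed.

Section Slot.
Variable F : {linear HHH -> HH}.
Hypothesis FM : forall be h, F (mulHHH be (cop3 h)) = mulHH (F be) (D h).

Lemma slot_bil : is_bilinear (fun (be : HHH) (v : V) => tp2 (F be) v).
Proof.
split=> [v k b b'|b k v v']; last exact: tp2_bilinear.2.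
by rewrite linearP tp2_bilinear.1.
Qed.

Lemma slot_bal (be : HHH) h v : tp2 (F (mulHHH be (cop3 h))) v = tp2 (F be) (hact h v).
Proof. by rewrite FM tp2_bal. Qed.

Definition slot : {linear tens3 V -> tens2 V} := balift slot_bil slot_bal.

Lemma slot_pure be v : slot (tp3 be v) = tp2 (F be) v.
Proof. exact: (balift_pure slot_bil slot_bal). Qed.

End Slot.

Lemma eps1M_cop3 (be : HHH) (h : H) : eps1 (mulHHH be (cop3 h)) = mulHH (eps1 be) (D h).
Proof. by rewrite eps1M eps1_cop3. Qed.

Lemma eps2M_cop3 (be : HHH) (h : H) : eps2 (mulHHH be (cop3 h)) = mulHH (eps2 be) (D h).
Proof. by rewrite eps2M eps2_cop3. Qed.

Lemma eps3M_cop3 (be : HHH) (h : H) : eps3 (mulHHH be (cop3 h)) = mulHH (eps3 be) (D h).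
Proof. by rewrite eps3M eps3_cop3. Qed.

Lemma contract_bil : is_bilinear (fun (be : HHH) (v : V) => hact (tau 1 be) v).
Proof.
split=> [v k b b'|b k v v']; first by rewrite linearP hactDl hactZl.
by rewrite hactDr hactZr.
Qed.

Lemma contract_bal (be : HHH) h v :
  hact (tau 1 (mulHHH be (cop3 h))) v = hact (tau 1 be) (hact h v).
Proof. by rewrite tauM_cop3 hactM. Qed.

Definition contract : {linear tens3 V -> V} := balift contract_bil contract_bal.

Lemma contract_pure be v : contract (tp3 be v) = hact (tau 1 be) v.
Proof. exact: (balift_pure contract_bil contract_bal). Qed.

End One.

Section Map2.
Variables (V W : hmodule H) (phi : {linear V -> W}).
Hypothesis phiH : forall h v, phi (hact h v) = hact h (phi v).

Lemma map2_bil : is_bilinear (fun (be : HH) (v : V) => tp2 be (phi v)).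
Proof.
split=> [v k b b'|b k v v']; first exact: (tp2_bilinear W).1.
by rewrite linearP (tp2_bilinear W).2.
Qed.

Lemma map2_bal (be : HH) (h : H) (v : V) :
  tp2 (mulHH be (D h)) (phi v) = tp2 be (phi (hact h v)).
Proof. by rewrite tp2_bal phiH. Qed.

Definition map2L : {linear tens2 V -> tens2 W} := balift map2_bil map2_bal.

Lemma map2E al : map2 phi al = map2L al.
Proof. by []. Qed.

Lemma map2L_pure be v : map2L (tp2 be v) = tp2 be (phi v).
Proof. exact: (balift_pure map2_bil map2_bal). Qed.

Lemma mu_map2 al : mu W (map2L al) = phi (mu V al).
Proof.
elim/tens2_ind: al => [|x y hx hy|be v]; first by rewrite !linear0.
  by rewrite !linearD hx hy.
by rewrite map2L_pure !mu_pure phiH.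
Qed.

Lemma xcoef_map2 x al : xcoef x (map2L al) = phi (xcoef x al).
Proof.
rewrite !xcoefE; elim/tens2_ind: al => [|a b ha hb|be v].
- by rewrite !linear0.
- by rewrite !linearD ha hb.
rewrite map2L_pure !left_form_pure.
elim/tensor_ind: (twist be) => [|a b ha hb|c d].
- by rewrite !linear0.
- by rewrite !linearD ha hb.
by rewrite !act2_pure !xeval_pure linearZZ phiH.
Qed.

End Map2.

(** * Contracting the associativity law *)

Section Assoc.
Variables (R V : hmodule H) (pV : R -> V -> tens2 V).
Hypotheses (pV_lin : is_bilinear pV) (pV_bil : pseudo_bilinear pV).

(** [pprodl] is a nested sum over chosen representatives. If [T] turns the inner terms into values
    of linear maps [F ga] on [tens2 V], the inner sum reassembles to a full pseudoproduct. *)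
Lemma pprodl_sum (Z : lmodType K) (T : {linear tens3 V -> Z})
    (F : HH -> tens2 V -> Z) (d : tens2 R) (c : V) :
  (forall ga, linear (F ga)) ->
  (forall ga be v, T (tp3 (mulHHH (injl ga) (copl be)) v) = F ga (tp2 be v)) ->
  T (pprodl pV d c) = \sum_(p <- repr d) F p.1 (pV p.2 c).
Proof.
move=> F_lin TF; rewrite linear_sum; apply: eq_bigr => p _.
transitivity (mk_linear (F_lin p.1) (\sum_(q <- repr (pV p.2 c)) tp2 q.1 q.2));
  last by rewrite tens2_reprE.
rewrite linear_sum (linear_sum (mk_linear (F_lin p.1))).
by apply: eq_bigr => q _; rewrite TF.
Qed.

Lemma pprodr_sum (Z : lmodType K) (T : {linear tens3 V -> Z})
    (F : HH -> tens2 V -> Z) (a : R) (d : tens2 V) :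
  (forall ga, linear (F ga)) ->
  (forall ga be v, T (tp3 (mulHHH (injr ga) (copr be)) v) = F ga (tp2 be v)) ->
  T (pprodr pV a d) = \sum_(p <- repr d) F p.1 (pV a p.2).
Proof.
move=> F_lin TF; rewrite linear_sum; apply: eq_bigr => p _.
transitivity (mk_linear (F_lin p.1) (\sum_(q <- repr (pV a p.2)) tp2 q.1 q.2));
  last by rewrite tens2_reprE.
rewrite linear_sum (linear_sum (mk_linear (F_lin p.1))).
by apply: eq_bigr => q _; rewrite TF.
Qed.

Lemma pV_hactl h a v : pV (hact h a) v = lact2L V (t2 h 1) (pV a v).
Proof. by rewrite -lact2E -pV_bil hact1. Qed.

Lemma pV_hactr h a v : pV a (hact h v) = lact2L V (t2 1 h) (pV a v).
Proof. by rewrite -lact2E -pV_bil hact1. Qed.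

Lemma dot_lin v : linear (fun a => mu V (pV a v)).
Proof. by move=> k a b; rewrite (bilinDl pV_lin) (bilinZl pV_lin) linearP. Qed.

Lemma circ_lin a : linear (fun v => nu V (pV a v)).
Proof. by move=> k v w; rewrite (bilinDr pV_lin) (bilinZr pV_lin) linearP. Qed.

Definition dot v : {linear R -> V} := mk_linear (dot_lin v).
Definition circ a : {linear V -> V} := mk_linear (circ_lin a).

Lemma dotE a v : dot v a = mu V (pV a v).
Proof. by []. Qed.

Lemma circE a v : circ a v = nu V (pV a v).
Proof. by []. Qed.

Lemma dotH v h a : dot v (hact h a) = hact h (dot v a).
Proof. by rewrite !dotE pV_hactl mu_lact2 epsr_pure ue_eps1 scale1r. Qed.

Lemma circH a h v : circ a (hact h v) = hact h (circ a v).
Proof. by rewrite !circE pV_hactr nu_lact2 epsl_pure ue_eps1 scale1r. Qed.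

(** The factor $h$ enters the second slot of the pseudoproduct, which [mu] evaluates by the
    counit. *)
Lemma dot_hactr a h v : dot (hact h v) a = eps h *: dot v a.
Proof. by rewrite !dotE pV_hactr mu_lact2 epsr_pure hactZl hact1. Qed.

Lemma dot_linr a : linear (fun v => dot v a).
Proof. by move=> k v w; rewrite !dotE (bilinDr pV_lin) (bilinZr pV_lin) linearP. Qed.

Lemma dotDr a v w : dot (v + w) a = dot v a + dot w a.
Proof. by have := dot_linr a 1 v w; rewrite !scale1r. Qed.

Lemma slot1_pprodl d c :
  slot V (@eps1M_cop3) (pprodl pV d c) = pV (nu R d) c.
Proof.
rewrite (pprodl_sum (F := fun ga al => lact2L V (t2 (epsl ga) 1) al)).
(* True by conversion: [nu] is a [tlift], hence the sum over the same representative of [d]. *)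
- have -> : nu R d = \sum_(p <- repr d) hact (epsl p.1) p.2 by [].
  by rewrite (bilin_suml pV_lin); apply: eq_bigr => p _; rewrite pV_hactl.
- by move=> ga; apply: linearP.
move=> ga be v.
by rewrite slot_pure eps1M eps1_injl coplE eps1_copl lact2L_pure.
Qed.

Lemma slot1_pprodr a d :
  slot V (@eps1M_cop3) (pprodr pV a d) = map2L (circH a) d.
Proof.
rewrite (pprodr_sum (F := fun ga al => tp2 ga (nu V al))) //.
- by move=> ga k al be; rewrite linearP (tp2_bilinear V).2.
move=> ga be v; rewrite slot_pure eps1M injrE eps1_injr coprE eps1_copr.
by rewrite tp2_bal nu_pure.
Qed.

Lemma slot2_pprodl d c :
  slot V (@eps2M_cop3) (pprodl pV d c) = pV (mu R d) c.
Proof.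
rewrite (pprodl_sum (F := fun ga al => lact2L V (t2 (epsr ga) 1) al)).
- have -> : mu R d = \sum_(p <- repr d) hact (epsr p.1) p.2 by [].
  by rewrite (bilin_suml pV_lin); apply: eq_bigr => p _; rewrite pV_hactl.
- by move=> ga; apply: linearP.
move=> ga be v.
by rewrite slot_pure eps2M eps2_injl coplE eps2_copl lact2L_pure.
Qed.

Lemma slot2_pprodr a d :
  slot V (@eps2M_cop3) (pprodr pV a d) = pV a (nu V d).
Proof.
rewrite (pprodr_sum (F := fun ga al => lact2L V (t2 1 (epsl ga)) al)).
- have -> : nu V d = \sum_(p <- repr d) hact (epsl p.1) p.2 by [].
  by rewrite (bilin_sumr pV_lin); apply: eq_bigr => p _; rewrite pV_hactr.
- by move=> ga; apply: linearP.
move=> ga be v.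
by rewrite slot_pure eps2M injrE eps2_injr coprE eps2_copr lact2L_pure.
Qed.

Lemma slot3_pprodl d c :
  slot V (@eps3M_cop3) (pprodl pV d c) = map2L (dotH c) d.
Proof.
rewrite (pprodl_sum (F := fun ga al => tp2 ga (mu V al))) //.
- by move=> ga k al be; rewrite linearP (tp2_bilinear V).2.
move=> ga be v; rewrite slot_pure eps3M eps3_injl coplE eps3_copl.
by rewrite tp2_bal mu_pure.
Qed.

Lemma slot3_pprodr a d :
  slot V (@eps3M_cop3) (pprodr pV a d) = pV a (mu V d).
Proof.
rewrite (pprodr_sum (F := fun ga al => lact2L V (t2 1 (epsr ga)) al)).
- have -> : mu V d = \sum_(p <- repr d) hact (epsr p.1) p.2 by [].
  by rewrite (bilin_sumr pV_lin); apply: eq_bigr => p _; rewrite pV_hactr.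
- by move=> ga; apply: linearP.
move=> ga be v.
by rewrite slot_pure eps3M injrE eps3_injr coprE eps3_copr lact2L_pure.
Qed.

Lemma theta_bil a : is_bilinear (fun (ga : HH) v => hact (aS ga) (dot v a)).
Proof.
split=> [v k b b'|b k v v']; first by rewrite linearP hactDl hactZl.
by rewrite dot_linr hactDr hactZr.
Qed.

Lemma theta_bal a (ga : HH) h v :
  hact (aS (mulHH ga (D h))) (dot v a) = hact (aS ga) (dot (hact h v) a).
Proof. by rewrite aSM_cop dot_hactr hactZl hactZr. Qed.

(** $(f\otimes g)\otimes_Hv\mapsto gS(f)(a.v)$, the contraction of $a*d$ seen as a function of $d$
    ([contract_pprodr]). *)
Definition theta a : {linear tens2 V -> V} := balift (theta_bil a) (theta_bal a).

Lemma theta_pure a ga v : theta a (tp2 ga v) = hact (aS ga) (dot v a).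
Proof. exact: (balift_pure (theta_bil a) (theta_bal a)). Qed.

Lemma contract_pprodr a d : contract V (pprodr pV a d) = theta a d.
Proof.
rewrite (pprodr_sum (F := fun ga al => hact (aS ga) (mu V al))) //.
- by move=> ga k al be; rewrite linearP hactDr hactZr.
move=> ga be v; rewrite contract_pure injrE coprE tau_injr_copr.
by rewrite hactM mu_pure.
Qed.

Lemma injlM (x y : HH) : injl (mulHH x y) = mulHHH (injl x) (injl y).
Proof. by rewrite /injl mulHHH_pure mulr1. Qed.

Lemma pprodl_inner_bil (ga : HH) :
  is_bilinear (fun (be : HH) (v : V) => tp3 (mulHHH (injl ga) (coplL be)) v).
Proof.
split=> [v k b b'|b k v v']; last exact: (tp3_bilinear V).2.
by rewrite linearP mulHHHDr (bilinZr (mulHHH_bilinear H)) (tp3_bilinear V).1.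
Qed.

Lemma pprodl_inner_bal (ga be : HH) (h : H) (v : V) :
  tp3 (mulHHH (injl ga) (coplL (mulHH be (D h)))) v =
  tp3 (mulHHH (injl ga) (coplL be)) (hact h v).
Proof. by rewrite coplM mulHHHA tp3_bal. Qed.

Definition pprodl_inner ga : {linear tens2 V -> tens3 V} :=
  balift (pprodl_inner_bil ga) (pprodl_inner_bal ga).

Lemma pprodl_inner_pure ga be v :
  pprodl_inner ga (tp2 be v) = tp3 (mulHHH (injl ga) (coplL be)) v.
Proof. exact: (balift_pure (pprodl_inner_bil ga) (pprodl_inner_bal ga)). Qed.

(** Lets [pprodl] be computed from a given expression, here $e*e=(1\otimes1)\otimes_He$.
    Balancedness: replacing $b$ by $hb$ puts $h\otimes 1$ on the left of $b*c$, and [copl] turns it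
    into $\Delta(h)\otimes 1$. *)
Lemma pprodl_pure ga b c : pprodl pV (tp2 ga b) c = pprodl_inner ga (pV b c).
Proof.
apply: (tlift_pure (f := fun ga b => pprodl_inner ga (pV b c))).
  split=> [a k x y|x k a a']; last by rewrite (bilinDl pV_lin) (bilinZl pV_lin) linearP.
  elim/tens2_ind: (pV a c) => [|al be hal hbe|be v].
  - by rewrite !linear0 addr0.
  - by rewrite !linearD hal hbe addrACA.
  rewrite !pprodl_inner_pure /injl tprodDl tprodZl mulHHHDl.
  by rewrite (bilinZl (mulHHH_bilinear H)) (tp3_bilinear V).1.
move=> x h a; rewrite pV_hactl.
elim/tens2_ind: (pV a c) => [|al be hal hbe|be v]; first by rewrite !linear0.
  by rewrite !linearD hal hbe.
rewrite lact2L_pure !pprodl_inner_pure coplM copl_pure -/(injl (D h)) mulHHHA.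
by rewrite injlM.
Qed.

Lemma contract_pprodl b c :
  contract V (pprodl pV (tp2 (t2 1 1) b) c) = circ b c.
Proof.
rewrite pprodl_pure circE.
elim/tens2_ind: (pV b c) => [|al be hal hbe|be v]; first by rewrite !linear0.
  by rewrite !linearD hal hbe.
by rewrite pprodl_inner_pure contract_pure nu_pure mul1HHH tau_copl.
Qed.

Variable pR : R -> R -> tens2 R.
Hypothesis pV_assoc : pseudo_assoc pR pV.

(* The counit applied to the first, second and third slot of associativity. *)
Lemma pV_nu a b v : pV (nu R (pR a b)) v = map2L (circH a) (pV b v).
Proof. by rewrite -slot1_pprodl pV_assoc slot1_pprodr. Qed.

Lemma pV_mu a b v : pV (mu R (pR a b)) v = pV a (circ b v).
Proof. by rewrite -slot2_pprodl pV_assoc slot2_pprodr. Qed.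

Lemma pV_dot a b v : pV a (dot v b) = map2L (dotH v) (pR a b).
Proof. by rewrite -slot3_pprodl pV_assoc slot3_pprodr. Qed.

(** The reconstruction formula: contracting $(a*a)*v=a*(a*v)$ gives $a\circ v$ on the left and
    [theta] on the right. *)
Lemma theta_unit a v : pR a a = tp2 (t2 1 1) a -> theta a (pV a v) = circ a v.
Proof. by move=> aa; rewrite -contract_pprodr -pV_assoc aa contract_pprodl. Qed.

Lemma dot_mu a b v : dot (dot v b) a = dot v (mu R (pR a b)).
Proof. by rewrite dotE pV_dot mu_map2. Qed.

End Assoc.
End HModules.

(** * Spanning by ordered monomials *)

Section Span.
Variables (K : fieldType) (U : lmodType K).

Definition inspan (I : Type) (F : I -> U) (u : U) : Prop :=
  exists s : seq (K * I), u = \sum_(p <- s) p.1 *: F p.2.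

Lemma inspan_mem I (F : I -> U) i : inspan F (F i).
Proof. by exists [:: (1, i)]; rewrite big_cons big_nil addr0 scale1r. Qed.

Lemma inspan0 I (F : I -> U) : inspan F 0.
Proof. by exists [::]; rewrite big_nil. Qed.

Lemma inspan_lin I (F : I -> U) k u v :
  inspan F u -> inspan F v -> inspan F (k *: u + v).
Proof.
move=> [s ->] [r ->]; exists ([seq (k * p.1, p.2) | p <- s] ++ r).
rewrite big_cat big_map scaler_sumr; congr (_ + _).
by apply: eq_bigr => p _; rewrite scalerA.
Qed.

Lemma inspanD I (F : I -> U) u v : inspan F u -> inspan F v -> inspan F (u + v).
Proof. by move=> hu hv; rewrite -[u]scale1r; apply: inspan_lin. Qed.

Lemma inspan_sub I J (F : I -> U) (G : J -> U) u :
  (forall i, inspan G (F i)) -> inspan F u -> inspan G u.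
Proof.
move=> FG [s ->]; elim: s => [|p s IH].
  by rewrite big_nil; apply: inspan0.
by rewrite big_cons; apply: inspan_lin.
Qed.

Lemma inspan_sum I J (F : I -> U) (s : seq J) (c : J -> K) (G : J -> U) :
  (forall j, inspan F (G j)) -> inspan F (\sum_(j <- s) c j *: G j).
Proof.
move=> FG; apply: (inspan_sub FG); exists [seq (c j, j) | j <- s].
by rewrite big_map.
Qed.

End Span.

Lemma dual0 (K : fieldType) (g : lie_algebra K) (H : enveloping g) (x : dual H) :
  x 0 = 0.
Proof. exact: (linear0 (x : {scalar H})). Qed.

Section PBW.
Variables (K : fieldType) (g : lie_algebra K) (H : enveloping g).
Variable B : dual_bases H.

Local Notation n := (\dim {:g}).
Local Notation inj := (ue_inj H).
Local Notation d := (db_g B).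

Definition word (s : seq 'I_n) : H := \prod_(i <- s) inj (tnth d i).

Lemma inj_span y : exists c : 'I_n -> K, inj y = \sum_(i < n) c i *: inj (tnth d i).
Proof.
exists (fun i => coord d i y).
have yd : y \in <<d>>%VS by rewrite (span_basis (db_basis B)) memvf.
rewrite {1}(coord_span yd) linear_sum; apply: eq_bigr => i _.
by rewrite linearZZ (tnth_nth 0).
Qed.

Lemma word_span h : inspan word h.
Proof.
elim/(@ue_ind _ _ H): h => [|k x y|y h [s ->]].
- by rewrite -(big_nil 1 *%R xpredT (fun i => inj (tnth d i))); apply: (inspan_mem word).
- exact: inspan_lin.
rewrite mulr_sumr; under eq_bigr do rewrite -scalerAr.
apply: inspan_sum => p; have [c ->] := inj_span y.
rewrite mulr_suml; under eq_bigr do rewrite -scalerAl.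
apply: inspan_sum => i; rewrite -[_ * _](big_cons 1 *%R i p.2 xpredT (fun i => inj (tnth d i))).
exact: (inspan_mem word).
Qed.

Lemma word_cat s r : word (s ++ r) = word s * word r.
Proof. exact: big_cat. Qed.

Lemma word_cons i s : word (i :: s) = inj (tnth d i) * word s.
Proof. exact: big_cons. Qed.

Section Level.
Variable m : nat.
Hypothesis IH : forall s, size s = m -> inspan (db_pbw B) (word s).

(** Exchanging two adjacent letters costs a bracket, whose expansion in the basis consists of words
    of length [m], covered by [IH]. *)
Lemma word_swap s i j r : (size s + size r).+1 = m ->
  inspan (db_pbw B) (word (s ++ i :: j :: r)) ->
  inspan (db_pbw B) (word (s ++ j :: i :: r)).
Proof.
move=> sz ws; pose y := lie_br (tnth d j) (tnth d i).
have -> : word (s ++ j :: i :: r) =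
    word s * (inj y * word r) + word (s ++ i :: j :: r).
  rewrite !word_cat !word_cons -mulrDr; congr (_ * _).
  by rewrite ue_injB mulrBl !mulrA subrK.
apply: inspanD => //; have [c ->] := inj_span y.
rewrite mulr_suml mulr_sumr.
under eq_bigr do rewrite -scalerAl -scalerAr -word_cons -word_cat.
apply: inspan_sum => k.
by apply: IH; rewrite size_cat /= addnS.
Qed.

Lemma word_front s i r t : (size s + size r + size t)%N = m ->
  inspan (db_pbw B) (word (s ++ r ++ i :: t)) ->
  inspan (db_pbw B) (word (s ++ i :: r ++ t)).
Proof.
elim/last_ind: r t => [//|r j IHr] t; rewrite size_rcons => sz ws.
rewrite cat_rcons; apply: IHr.
  by rewrite -sz /= !addnS addSn.
rewrite catA; apply: word_swap.
  by rewrite -sz size_cat !addnS addSn.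
by rewrite -catA -cat_rcons.
Qed.

(** Induction on the target [t]: its first letter occurs in [r], is pulled to the front by
    [word_front], and is then counted as part of the prefix. *)
Lemma word_perm s r t : perm_eq r t -> (size s + size r)%N = m.+1 ->
  inspan (db_pbw B) (word (s ++ r)) -> inspan (db_pbw B) (word (s ++ t)).
Proof.
elim: t s r => [|i t IHt] s r rt sz; first by rewrite (perm_nilP rt).
have /splitPr ir : i \in r by rewrite (perm_mem rt) mem_head.
case: ir rt sz => r1 r2 rt sz ws.
rewrite -cat_rcons; apply: (IHt _ (r1 ++ r2)).
- rewrite -(perm_cons i); apply: perm_trans rt.
  by rewrite perm_sym -[i :: r2]cat1s perm_catCA.
- by rewrite -sz size_rcons !size_cat /= !addnS addSn.
rewrite cat_rcons; apply: word_front => //.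
by apply: succn_inj; rewrite -sz size_cat /= !addnS addnA.
Qed.

End Level.

(** Induction on length: up to shorter words [s] equals its sorted version [t], which is a multiple
    of a PBW monomial. *)
Lemma word_pbw s : inspan (db_pbw B) (word s).
Proof.
have [m] := ubnP (size s); elim: m s => // m IHm s; rewrite ltnS => sm.
pose t := flatten [seq nseq (count_mem i s) i | i <- index_enum 'I_n].
have st : perm_eq s t.
  apply/allP => i _ /=; rewrite count_flatten -map_comp.
  rewrite sumnE big_map /= (bigD1_seq i) ?mem_index_enum ?index_enum_uniq //=.
  rewrite count_nseq /= eqxx mul1n big1 ?addn0 // => j /negPf ji.
  by rewrite count_nseq /= ji.
have wt : inspan (db_pbw B) (word t).
  pose I : midx g := [ffun i => count_mem i s].
  have -> : word t = (\prod_(i < n) (I i)`!%:R) *: db_pbw B I.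
    rewrite /db_pbw /pbw scalerA mulfV ?scale1r.
      rewrite /word /t big_flatten big_map; apply: eq_bigr => i _.
      by rewrite big_nseq ffunE iter_mulr_1.
    (* The factorials are nonzero in [K]: otherwise their inverse is $0$ by convention, the PBW
       monomial vanishes, and its pairing with $t^I$ could not be $1$. *)
    apply/negP => /eqP I0; have := db_dual B I I.
    rewrite /pbw I0 invr0 scale0r dual0 eqxx => /esym/eqP.
    by rewrite oner_eq0.
  rewrite -[_ *: _]addr0; apply: inspan_lin; last exact: inspan0.
  exact: inspan_mem.
case sz: (size s) => [|k].
  suff -> : s = t by [].
  by rewrite (size0nil sz); apply/esym/size0nil; rewrite -(perm_size st).
apply: (@word_perm k _ [::] t) => //.
- by move=> r rk; apply: IHm; rewrite rk -sz.
- by rewrite perm_sym.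
by rewrite add0n -(perm_size st).
Qed.

Lemma pbw_span h : inspan (db_pbw B) h.
Proof. exact: (inspan_sub word_pbw (word_span h)). Qed.

(** The expansion is stated over every duplicate-free list containing the support, so that several
    elements can be expanded over one list. *)
Lemma pbw_expand h : exists s : seq (midx g),
  (forall I, I \notin s -> db_t B I h = 0) /\
  (forall r, uniq r -> {subset s <= r} ->
     h = \sum_(I <- r) db_t B I h *: db_pbw B I).
Proof.
have [s ->] := pbw_span h; exists [seq p.2 | p <- s]; elim: s => [|p s [IH0 IH]].
  rewrite big_nil; split=> [I _|r _ _]; first exact: dual0.
  by rewrite big1 // => I _; rewrite dual0 scale0r.
have tE I : db_t B I (\sum_(q <- p :: s) q.1 *: db_pbw B q.2) =
    p.1 * (I == p.2)%:R + db_t B I (\sum_(q <- s) q.1 *: db_pbw B q.2).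
  by rewrite big_cons dualP /db_pbw db_dual.
split=> [I|r r_uniq sr].
  rewrite inE negb_or => /andP[/negPf Ip Is].
  by rewrite tE Ip mulr0 add0r IH0.
under [RHS]eq_bigr do rewrite tE scalerDl.
rewrite big_split /= -IH // => [|I Is]; last by apply: sr; rewrite inE Is orbT.
rewrite big_cons; congr (_ + _); have pr : p.2 \in r by apply: sr; rewrite mem_head.
rewrite (bigD1_seq p.2) //= big1 ?addr0 => [|I /negPf Ip]; last first.
  by rewrite Ip mulr0 scale0r.
by rewrite eqxx mulr1.
Qed.

Lemma left_form_expand (V : hmodule H) (al : tensor H V) :
  exists s : seq (midx g),
  (forall I, I \notin s -> xeval V (db_t B I) al = 0) /\
  (forall r, uniq r -> {subset s <= r} ->
     al = \sum_(I <- r) tprod (db_pbw B I) (xeval V (db_t B I) al)).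
Proof.
elim/tensor_ind: al => [|al be [s [s0 sE]] [s' [s'0 s'E]]|h v].
- exists [::]; split=> [I _|r _ _]; first by rewrite linear0.
  by rewrite big1 // => I _; rewrite linear0 (bilin0r (tprod_bilinear _ _)).
- exists (s ++ s'); split=> [I|r r_uniq sr].
    by rewrite mem_cat negb_or => /andP[sI s'I]; rewrite linearD s0 // s'0 // addr0.
  under eq_bigr do rewrite linearD tprodDr.
  rewrite big_split /= -sE // => [|I Is]; last by apply: sr; rewrite mem_cat Is.
  by rewrite -s'E // => I Is; apply: sr; rewrite mem_cat Is orbT.
have [s [s0 sE]] := pbw_expand h; exists s; split=> [I Is|r r_uniq sr].
  by rewrite xeval_pure s0 // scale0r.
under eq_bigr do rewrite xeval_pure tprodZr -tprodZl.
by rewrite -(bilin_suml (tprod_bilinear _ _)) -sE.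
Qed.

Lemma tens2_expand (V : hmodule H) (al : tens2 V) :
  exists s : seq (midx g),
  (forall I, I \notin s -> xcoef (db_t B I) al = 0) /\
  (forall r, uniq r -> {subset s <= r} ->
     al = \sum_(I <- r) tp2 (tprod (ue_S H (db_pbw B I)) 1)
                           (xcoef (db_t B I) al)).
Proof.
have [s [s0 sE]] := left_form_expand (left_form V al).
exists s; split=> [I Is|r r_uniq sr]; first by rewrite xcoefE s0.
rewrite -[LHS]left_formK {1}(sE r) // (linear_sum (of_left_form V)).
by apply: eq_bigr => I _; rewrite of_left_form_pure xcoefE.
Qed.

(** Expand both sides over one list containing both supports. *)
Lemma tens2_xcoef_ext (V : hmodule H) (al be : tens2 V) :
  (forall x, xcoef x al = xcoef x be) -> al = be.
Proof.
move=> ab; have [s [_ sE]] := tens2_expand al; have [r [_ rE]] := tens2_expand be.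
have us := undup_uniq (s ++ r).
rewrite (sE _ us) => [|I Is]; last by rewrite mem_undup mem_cat Is.
rewrite [RHS](rE _ us) => [|I Is]; last by rewrite mem_undup mem_cat Is orbT.
by apply: eq_bigr => I _; rewrite ab.
Qed.

End PBW.

(** * Differential pseudoalgebras *)

Section Tilde.
Variables (K : fieldType) (g : lie_algebra K) (H : enveloping g).

Lemma tilde_ind (U : lmodType K) (P : free_hmod H U -> Prop) :
  P 0 -> (forall x y, P x -> P y -> P (x + y)) ->
  (forall (h : H) u, P (hact h (@tilde _ _ H _ u))) -> forall x, P x.
Proof.
move=> P0 PD Pt; elim/tensor_ind => // h u.
have -> : tprod h u = hact (h : H) (@tilde _ _ H _ u); last exact: Pt.
by rewrite /tilde [RHS]free_act_pure mulr1.
Qed.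

Lemma hact_tilde (U : lmodType K) (h : H) (u : U) :
  hact h (@tilde _ _ H _ u) = tprod h u.
Proof. by rewrite /tilde [LHS]free_act_pure mulr1. Qed.

Lemma tilde_lin (U : lmodType K) : linear (@tilde _ _ H U).
Proof. by move=> k u v; rewrite /tilde tprodDr tprodZr. Qed.

Lemma tilde0 (U : lmodType K) : @tilde _ _ H _ (0 : U) = 0.
Proof. exact: bilin0r (tprod_bilinear _ _) _. Qed.

Lemma xeval_counit_tilde (U : lmodType K) (u : U) :
  xeval U (counit H) (@tilde _ _ H _ u) = u.
Proof. by rewrite xeval_pure [counit H 1]ue_eps1 scale1r. Qed.

Lemma tilde_inj (U : lmodType K) : injective (@tilde _ _ H U).
Proof. exact: can_inj (@xeval_counit_tilde U). Qed.

End Tilde.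

Section DiffA.
Variables (K : fieldType) (g : lie_algebra K) (H : enveloping g).
Variables (B : dual_bases H) (A : xcop_algebra B) (e : A) (D : Diff A).
Hypothesis e_id : xcop_identity e.

Local Notation HH := (HH H).
Local Notation eps := (ue_eps H).
Local Notation S := (ue_S H).
Local Notation t2 a b := (tprod (a : H) (b : H) : HH) (only parsing).
Local Notation tl := (@tilde _ _ H _).
Local Notation R := (free_hmod H A).
Local Notation pR := (diff_prod D).
Local Notation act I a := (xcop_act (db_t B I) a).
Local Notation dd := (db_pbw B).

(** Both sides have the same $x$-products, because $a\,x(1)=\langle x,1\rangle a$. *)
Lemma diff_tilde_e (a : A) : pR (tl a) (tl e) = tp2 (t2 1 1) (tl a).
Proof.
have [_ ae xe] := e_id; apply: (tens2_xcoef_ext B) => x.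
rewrite diff_xprod xe (bilinZr (xcop_mul_bilinear A)) ae xcoefE left_form1.
by rewrite ue_S1 xeval_pure /tilde tprodZr.
Qed.

(** The $t^I$-products of $\tilde 1*\tilde a$ are the $\widetilde{t^I(a)}$, and a pseudotensor has
    only finitely many nonzero ones. *)
Lemma act_support (a : A) : exists s : seq (midx g),
  forall I, I \notin s -> act I a = 0.
Proof.
have [ea _ _] := e_id; have [s [s0 _]] := tens2_expand B (pR (tl e) (tl a)).
exists s => I /s0; rewrite diff_xprod ea => /eqP.
by rewrite -(tilde0 H A) (inj_eq (@tilde_inj _ _ H A)) => /eqP.
Qed.

Lemma diff_e_tilde (a : A) (s : seq (midx g)) : uniq s ->
  (forall I, I \notin s -> act I a = 0) ->
  pR (tl e) (tl a) = \sum_(I <- s) tp2 (t2 (S (dd I)) 1) (tl (act I a)).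
Proof.
move=> us s0; have [ea _ _] := e_id.
have [r [r0 rE]] := tens2_expand B (pR (tl e) (tl a)).
(* Pass to a list containing both supports, then drop the terms outside [s], which vanish. *)
rewrite (rE (undup (s ++ r))) ?undup_uniq //; last first.
  by move=> I Ir; rewrite mem_undup mem_cat Ir orbT.
under eq_bigr do rewrite diff_xprod ea.
rewrite -(big_rmcond_in (fun I => I \in s)) /= => [|I _ Is].
  rewrite -big_filter; apply: perm_big; apply: uniq_perm => //.
    by rewrite filter_uniq ?undup_uniq.
  by move=> I; rewrite mem_filter mem_undup mem_cat; case: (I \in s).
by rewrite s0 // tilde0 (bilin0r (tp2_bilinear _)).
Qed.

Lemma nu_diff (a b : A) : nu R (pR (tl a) (tl b)) = tl (xcop_mul a b).
Proof. by rewrite -xcoef_counit diff_xprod xcop_act_counit. Qed.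

Lemma mu_diff_e (a : R) : mu R (pR a (tl e)) = a.
Proof.
rewrite -(dotE (diff_linear D)); elim/tilde_ind: a => [|a b ha hb|h a].
- by rewrite linear0.
- by rewrite linearD ha hb.
rewrite (dotH _ (diff_bilinear D)) dotE diff_tilde_e mu_pure epsr_pure.
by rewrite ue_eps1 scale1r hact1.
Qed.

Lemma nu_e_diff (a : R) : nu R (pR (tl e) a) = a.
Proof.
have [ea _ _] := e_id.
rewrite -(circE (diff_linear D)); elim/tilde_ind: a => [|a b ha hb|h a].
- by rewrite linear0.
- by rewrite linearD ha hb.
by rewrite (circH _ (diff_bilinear D)) circE nu_diff ea.
Qed.

(** The expansion of $\varepsilon$ along $t^I$, acting on $a$; obtained by applying [nu] to the
    expansion of $\tilde 1*\tilde a$. *)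
Lemma act_expand (a : A) (s : seq (midx g)) : uniq s ->
  (forall I, I \notin s -> act I a = 0) ->
  \sum_(I <- s) eps (dd I) *: act I a = a.
Proof.
move=> us s0; apply: (@tilde_inj _ _ H).
have tlS F : tl (\sum_(I <- s) F I) = \sum_(I <- s) tl (F I).
  exact: (bilin_sumr (tprod_bilinear _ _)).
rewrite -[RHS]nu_e_diff (diff_e_tilde us s0) (linear_sum (nu R)) tlS.
apply: eq_bigr => I _; rewrite nu_pure epsl_pure ue_eps_S hactZl hact1.
by rewrite /tilde tprodZr.
Qed.

Section TildeProd.
Variable M : amodule A.

(* The element [u] such that [a~ * m~ = (1 (x) 1) (x)_H u]. *)
Definition tilde_dot (a : A) (m : M) : free_hmod H M :=
  \sum_(I \in [set: midx g]) hact (dd I) (tl (am_act (act I a) m)).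

Lemma tilde_dotE (a : A) (m : M) (s : seq (midx g)) : uniq s ->
  (forall I, I \notin s -> act I a = 0) ->
  tilde_dot a m = \sum_(I <- s) hact (dd I) (tl (am_act (act I a) m)).
Proof.
move=> us s0; rewrite /tilde_dot (fsbigE s) // => [|I _ Is].
  by apply: eq_bigl => I; rewrite in_setT.
by rewrite s0 // (bilin0l (am_bilinear M)) tilde0 hact0r.
Qed.

Lemma act_support2 (a b : A) : exists s : seq (midx g), [/\ uniq s,
  forall I, I \notin s -> act I a = 0 & forall I, I \notin s -> act I b = 0].
Proof.
have [s s0] := act_support a; have [r r0] := act_support b.
exists (undup (s ++ r)); split; first exact: undup_uniq.
  by move=> I; rewrite mem_undup mem_cat negb_or => /andP[/s0].
by move=> I; rewrite mem_undup mem_cat negb_or => /andP[_ /r0].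
Qed.

Lemma tilde_dot_bil : is_bilinear tilde_dot.
Proof.
split=> [m k a b|a k m n].
  have [s [us a0 b0]] := act_support2 a b.
  rewrite !(tilde_dotE _ us) //; last first.
    move=> I Is; rewrite (bilinDr (xcop_act_bilinear A)).
    by rewrite (bilinZr (xcop_act_bilinear A)) a0 // b0 // scaler0 addr0.
  rewrite scaler_sumr -big_split; apply: eq_bigr => I _.
  rewrite (bilinDr (xcop_act_bilinear A)) (bilinZr (xcop_act_bilinear A)).
  rewrite (bilinDl (am_bilinear M)) (bilinZl (am_bilinear M)) tilde_lin.
  by rewrite hactDr hactZr.
have [s [us a0 _]] := act_support2 a a.
rewrite !(tilde_dotE _ us) // scaler_sumr -big_split; apply: eq_bigr => I _.
rewrite (bilinDr (am_bilinear M)) (bilinZr (am_bilinear M)) tilde_lin.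
by rewrite hactDr hactZr.
Qed.

Lemma tilde_prod_inner_bil (f : H) (a : A) : is_bilinear (fun (h : H) (m : M) =>
  tp2 (V := free_hmod H M) (t2 f h) (tilde_dot a m)).
Proof.
split=> [m k h h'|h k m n].
  by rewrite tprodDr tprodZr (tp2_bilinear _).1.
by rewrite tilde_dot_bil.2 (tp2_bilinear _).2.
Qed.

Lemma tilde_prod_outer_bil (v : free_hmod H M) :
  is_bilinear (fun (f : H) (a : A) => blift (tilde_prod_inner_bil f a) v).
Proof.
split=> [a k f f'|f k a b]; elim/tensor_ind: v => [|x y hx hy|h m].
- by rewrite !linear0 addr0.
- by rewrite !linearD hx hy addrACA.
- by rewrite !blift_pure tprodDl tprodZl (tp2_bilinear _).1.
- by rewrite !linear0 addr0.
- by rewrite !linearD hx hy addrACA.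
by rewrite !blift_pure tilde_dot_bil.1 (tp2_bilinear _).2.
Qed.

Lemma tilde_prodE (u : free_hmod H A) (v : free_hmod H M) :
  tilde_prod u v = blift (tilde_prod_outer_bil v) u.
Proof. by []. Qed.

Lemma tilde_prod_bil : is_bilinear (@tilde_prod _ _ _ _ _ M).
Proof.
split=> [v k a b|u k v w]; rewrite !tilde_prodE ?linearP //.
elim/tensor_ind: u => [|x y hx hy|f a].
- by rewrite !linear0 addr0.
- by rewrite !linearD hx hy addrACA.
by rewrite !blift_pure linearP.
Qed.

Lemma tilde_prod_pure (f h : H) (a : A) (m : M) :
  tilde_prod (tprod f a : free_hmod H A) (tprod h m : free_hmod H M) =
  tp2 (t2 f h) (tilde_dot a m).
Proof.
transitivity (blift (tilde_prod_inner_bil f a) (tprod h m)).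
  exact: (blift_pure (tilde_prod_outer_bil _)).
exact: blift_pure.
Qed.

End TildeProd.
End DiffA.

(** * The unital part of a representation *)

Section Decomposition.
Variables (K : fieldType) (g : lie_algebra K) (H : enveloping g).
Variables (B : dual_bases H) (A : xcop_algebra B) (e : A) (D : Diff A).
Hypothesis e_id : xcop_identity e.

Local Notation HH := (HH H).
Local Notation eps := (ue_eps H).
Local Notation S := (ue_S H).
Local Notation t2 a b := (tprod (a : H) (b : H) : HH) (only parsing).
Local Notation tl := (@tilde _ _ H _).
Local Notation R := (free_hmod H A).
Local Notation pR := (diff_prod D).
Local Notation act I a := (xcop_act (db_t B I) a).
Local Notation dd := (db_pbw B).

Variables (V : hmodule H) (pV : R -> V -> tens2 V).
Hypotheses (pV_lin : is_bilinear pV) (pV_bil : pseudo_bilinear pV).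
Hypothesis pV_assoc : pseudo_assoc pR pV.

Local Notation dot := (dot pV_lin).

(* [proj v = e_1 v], the projection onto [V^1] along [V^0]. *)
Definition proj : {linear V -> V} := circ pV_lin (tl e).

(* On [V^1 = H (x) M] this is [h (x) m |-> eps(h) (1 (x) m)]; it vanishes on    *)
(* [V^0].                                                                       *)
Definition coinv : {linear V -> V} := mk_linear (dot_linr pV_lin (tl e)).

Lemma coinvE v : coinv v = dot v (tl e).
Proof. by []. Qed.

Lemma projE v : proj v = nu V (pV (tl e) v).
Proof. by []. Qed.

Lemma projH h v : proj (hact h v) = hact h (proj v).
Proof. exact: circH. Qed.

Lemma coinvH h v : coinv (hact h v) = eps h *: coinv v.
Proof. exact: dot_hactr. Qed.

(** $a*(e\circ v)=(a.e)*v$, and $a.e=a$ in $\mathrm{Diff}\,A$. *)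
Lemma pV_proj a v : pV a (proj v) = pV a v.
Proof. by rewrite -(pV_mu _ pV_bil pV_assoc) mu_diff_e. Qed.

(** $(\mathrm{id}\otimes(e\circ-))(a*v)=(e\circ a)*v$, and $e\circ a=a$. *)
Lemma map2_proj a v : map2L projH (pV a v) = pV a v.
Proof. by rewrite -(pV_nu _ pV_bil pV_assoc) nu_e_diff. Qed.

Lemma proj_proj v : proj (proj v) = proj v.
Proof. by rewrite {1}projE pV_proj. Qed.

Lemma theta_proj v : theta pV_lin pV_bil (tl e) (pV (tl e) v) = proj v.
Proof. exact: (theta_unit pV_lin pV_bil pV_assoc _ (diff_tilde_e D e_id e)). Qed.

Lemma pV_coinv a v : pV (tl a) (coinv v) = tp2 (t2 1 1) (dot v (tl a)).
Proof.
by rewrite coinvE (pV_dot _ pV_bil pV_assoc) (diff_tilde_e _ e_id) map2L_pure.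
Qed.

Lemma coinv_coinv v : coinv (coinv v) = coinv v.
Proof.
by rewrite [LHS]coinvE dotE pV_coinv mu_pure epsr_pure ue_eps1 scale1r hact1.
Qed.

Lemma dot_coinv a v : dot (coinv v) a = dot v a.
Proof.
by rewrite coinvE (dot_mu _ pV_bil pV_assoc) mu_diff_e.
Qed.

Lemma proj_coinv v : proj (coinv v) = coinv v.
Proof. by rewrite projE pV_coinv nu_pure epsl_pure ue_eps1 scale1r hact1. Qed.

Lemma proj_dot a v : proj (dot v a) = dot v a.
Proof. by rewrite dotE -(mu_map2 projH) map2_proj. Qed.

(** [coinv] sees the action of $H$ only through the counit, so on $(f\otimes g)\otimes_H c$ both
    sides carry the scalar $\varepsilon(f)\varepsilon(g)$. It trades $a.b$ for $a\circ b$, which is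
    the product of $A$. *)
Lemma coinv_dot_mu v (al : tens2 R) :
  coinv (dot v (mu R al)) = coinv (dot v (nu R al)).
Proof.
rewrite !coinvE !(dot_mu _ pV_bil pV_assoc) -!(dotE (diff_linear D)).
congr (dot v _); elim/tens2_ind: al => [|a b ha hb|be a].
- by rewrite !linear0.
- rewrite (linearD (mu R)) (linearD (nu R)).
  by rewrite !dotDr ha hb.
by rewrite mu_pure nu_pure !(dot_hactr _ (diff_bilinear D)) eps_epsr.
Qed.

(** Apply the reconstruction formula to $a.v$: here $e*(a.v)$ is the image of $e*\tilde a$, whose
    coefficients are the $\widetilde{t^I(a)}$. This is where the formula for $\widetilde M$ comes
    from. *)
Lemma dot_expand v a (s : seq (midx g)) : uniq s ->
  (forall I, I \notin s -> act I a = 0) ->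
  dot v (tl a) = \sum_(I <- s) hact (dd I) (coinv (dot v (tl (act I a)))).
Proof.
move=> us s0; rewrite -proj_dot -theta_proj (pV_dot _ pV_bil pV_assoc).
rewrite (diff_e_tilde _ e_id us s0).
rewrite (linear_sum (map2L (dotH pV_lin pV_bil v))).
rewrite (linear_sum (theta pV_lin pV_bil (tl e))); apply: eq_bigr => I _.
by rewrite map2L_pure theta_pure aS_pure ue_SS mul1r.
Qed.

Definition coinv_pred : {pred V} := [pred v | `[< coinv v = v >]].

Lemma coinv_pred_closed : GRing.submod_closed coinv_pred.
Proof.
split=> [|k u v /asboolP hu /asboolP hv]; apply/asboolP; first exact: linear0.
by rewrite linearP hu hv.
Qed.

Definition coinv_submod : submodClosed V :=
  HB.pack coinv_pred (GRing.isSubmodClosed.Build K V coinv_pred coinv_pred_closed).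

Local Notation M := (submod_type coinv_submod).

Lemma valM (m : M) : coinv (val m) = val m.
Proof. exact: asboolP (valP m). Qed.

Lemma coinv_in v : coinv v \in coinv_submod.
Proof. by apply/asboolP; apply: coinv_coinv. Qed.

Definition coinvM v : M := Sub (coinv v) (coinv_in v).

Lemma val_coinvM v : val (coinvM v) = coinv v.
Proof. exact: SubK. Qed.

Lemma coinvM_lin : linear coinvM.
Proof. by move=> k u v; apply: val_inj; rewrite linearP !val_coinvM linearP. Qed.

Definition coinv_act (a : A) (m : M) : M := coinvM (dot (val m) (tl a)).

Lemma coinv_act_bil : is_bilinear coinv_act.
Proof.
split=> [m k a b|a k m n]; rewrite /coinv_act.
  by rewrite tilde_lin linearP coinvM_lin.
by rewrite linearP dot_linr coinvM_lin.
Qed.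

Lemma coinv_act_mul a b m :
  coinv_act (xcop_mul a b) m = coinv_act a (coinv_act b m).
Proof.
apply: val_inj; rewrite !val_coinvM dot_coinv (dot_mu _ pV_bil pV_assoc).
by rewrite coinv_dot_mu nu_diff.
Qed.

Definition coinv_amodule : amodule A := AModule coinv_act_bil coinv_act_mul.

Lemma coinv_unitary : unitary e coinv_amodule.
Proof.
move=> m; apply: val_inj; rewrite val_coinvM -/(coinv _).
by rewrite -[dot (val m) (tl e)]/(coinv (val m)) !valM.
Qed.

Lemma span_bil : is_bilinear (fun (h : H) (m : M) => hact h (val m) : V).
Proof.
split=> [m k h h'|h k m n]; first by rewrite hactDl hactZl.
by rewrite linearP hactDr hactZr.
Qed.

Definition span_map : {linear free_hmod H coinv_amodule -> V} := blift span_bil.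

Lemma span_map_pure h (m : M) : span_map (tprod h m) = hact h (val m).
Proof. exact: blift_pure. Qed.

Lemma span_mapH h u : span_map (hact h u) = hact h (span_map u).
Proof.
elim/tilde_ind: u => [|x y hx hy|f m].
- by rewrite hact0r !linear0 hact0r.
- by rewrite hactDr !linearD hx hy hactDr.
by rewrite -hactM !hact_tilde !span_map_pure hactM.
Qed.

Lemma unspan_bil :
  is_bilinear (fun (be : HH) v => tprod (aS be) (coinvM v) : tensor H M).
Proof.
split=> [v k b b'|b k v w]; first by rewrite linearP tprodDl tprodZl.
by rewrite coinvM_lin tprodDr tprodZr.
Qed.

Lemma unspan_bal (be : HH) h v :
  tprod (aS (mulHH be (ue_cop H h))) (coinvM v) =
  tprod (aS be) (coinvM (hact h v)) :> tensor H M.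
Proof.
rewrite aSM_cop tprodZl -tprodZr; congr tprod; apply: val_inj.
by rewrite linearZZ !val_coinvM coinvH.
Qed.

(** $(a\otimes b)\otimes_Hv\mapsto bS(a)\otimes Pv$. It lifts [theta] at the pseudoidentity from $V$
    to $H\otimes M$ and supplies the left inverse of [span_map]. *)
Definition unspan : {linear tens2 V -> tensor H M} :=
  balift unspan_bil unspan_bal.

Lemma unspan_pure be v : unspan (tp2 be v) = tprod (aS be) (coinvM v).
Proof. exact: (balift_pure unspan_bil unspan_bal). Qed.

Lemma pV_val (m : M) a : pV (tl a) (val m) = tp2 (t2 1 1) (dot (val m) (tl a)).
Proof. by rewrite -{1}valM pV_coinv. Qed.

(** For $m$ in $M$ one has $e*(hm)=(1\otimes h)\otimes_Hm$, which [unspan] sends to $h\otimes m$. *)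
Lemma unspanK u : unspan (pV (tl e) (span_map u)) = u.
Proof.
elim/tilde_ind: u => [|x y hx hy|h m].
- by rewrite linear0 (bilin0r pV_lin) linear0.
- by rewrite (linearD span_map) (bilinDr pV_lin) (linearD unspan) hx hy.
rewrite hact_tilde span_map_pure (pV_hactr pV_bil) pV_val lact2L_pure.
rewrite mulHH_pure unspan_pure aS_pure !mulr1 ue_S1 mulr1; congr tprod.
by apply: val_inj; rewrite val_coinvM -[dot _ _]/(coinv (val m)) !valM.
Qed.

Lemma span_map_inj : injective span_map.
Proof. exact: (can_inj (g := fun v => unspan (pV (tl e) v)) unspanK). Qed.

Lemma proj_span_map u : proj (span_map u) = span_map u.
Proof.
elim/tilde_ind: u => [|x y hx hy|h m].
- by rewrite !linear0.
- by rewrite !linearD hx hy.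
by rewrite hact_tilde span_map_pure projH -valM proj_coinv.
Qed.

Lemma range_span_map : range span_map = [set v | proj v = v].
Proof.
apply/seteqP; split=> [_ [u _ <-]|v vE]; first exact: proj_span_map.
(* Each term of the reconstruction formula is visibly of the form $h\cdot Pw$. *)
rewrite -(vE : proj v = v) -theta_proj; elim/tens2_ind: (pV _ v) => [|x y [u _ hu] [w _ hw]|be w].
- by rewrite linear0; exists 0 => //; rewrite linear0.
- by exists (u + w) => //; rewrite linearD hu hw -linearD.
rewrite theta_pure; exists (tprod (aS be) (coinvM w)) => //.
by rewrite span_map_pure val_coinvM.
Qed.

Lemma pV_span_map (a : R) u :
  pV a (span_map u) = map2 span_map (tilde_prod a u).
Proof.
rewrite (map2E span_mapH).
elim/tilde_ind: u => [|x y hx hy|h m].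
- rewrite linear0 (bilin0r pV_lin) (bilin0r (tilde_prod_bil D e_id _)).
  by rewrite linear0.
- rewrite linearD (bilinDr pV_lin) hx hy.
  by rewrite (bilinDr (tilde_prod_bil D e_id _)) linearD.
elim/tilde_ind: a => [|x y hx hy|f a].
- by rewrite (bilin0l pV_lin) (bilin0l (tilde_prod_bil D e_id _)) linear0.
- by rewrite (bilinDl pV_lin) hx hy (bilinDl (tilde_prod_bil D e_id _)) linearD.
rewrite !hact_tilde (tilde_prod_pure D e_id) map2L_pure span_map_pure.
rewrite -hact_tilde pV_bil pV_val lact2E lact2L_pure mulHH_pure !mulr1.
congr tp2; have [s [us s0 _]] := act_support2 D e_id a a.
rewrite (dot_expand _ us s0) (tilde_dotE _ us s0) (linear_sum span_map).
apply: eq_bigr => I _.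
by rewrite hact_tilde span_map_pure val_coinvM.
Qed.

End Decomposition.

(** * Correspondence of submodules *)

Section Submodules.
Variables (K : fieldType) (g : lie_algebra K) (H : enveloping g).
Variables (B : dual_bases H) (A : xcop_algebra B) (e : A) (D : Diff A).
Hypothesis e_id : xcop_identity e.
Variable V : pseudomodule (diff_pseudoalgebra D).

Local Notation HH := (HH H).
Local Notation eps := (ue_eps H).
Local Notation S := (ue_S H).
Local Notation t2 a b := (tprod (a : H) (b : H) : HH) (only parsing).
Local Notation tl := (@tilde _ _ H _).
Local Notation R := (free_hmod H A).
Local Notation act I a := (xcop_act (db_t B I) a).
Local Notation dd := (db_pbw B).

Definition pm_pprod : R -> V -> tens2 V := @pm_prod _ _ _ _ V.

Definition pm_lin : is_bilinear pm_pprod := pm_linear V.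
Definition pm_bil : pseudo_bilinear pm_pprod := @pm_bilinear _ _ _ _ V.
Definition pm_ass : pseudo_assoc (diff_prod D) pm_pprod := @pm_assoc _ _ _ _ V.

Local Notation pV := pm_pprod.
Local Notation dot := (dot pm_lin).
Local Notation proj := (proj e pm_lin).
Local Notation coinv := (coinv e pm_lin).

Lemma subspaceD (U : lmodType K) (W : set U) u v :
  subspace W -> W u -> W v -> W (u + v).
Proof. by move=> [_ WL] Wu Wv; rewrite -[u]scale1r; apply: WL. Qed.

Lemma subspaceZ (U : lmodType K) (W : set U) k u : subspace W -> W u -> W (k *: u).
Proof. by move=> [W0 WL] Wu; rewrite -[_ *: _]addr0; apply: WL. Qed.

Lemma subspace_sum (U : lmodType K) (W : set U) I (s : seq I) (F : I -> U) :
  subspace W -> (forall i, W (F i)) -> W (\sum_(i <- s) F i).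
Proof.
move=> sW WF; elim: s => [|i s IH]; first by rewrite big_nil; case: sW.
by rewrite big_cons; apply: subspaceD.
Qed.

Section Sub.
Variable W : set V.
Hypothesis W_sub : pm_submodule W.

Lemma pm_subspace : subspace W. Proof. by case: W_sub. Qed.

Lemma pm_hact h w : W w -> W (hact h w).
Proof. by case: W_sub => _ + _; apply. Qed.

Lemma pm_xcoef x a w : W w -> W (xcoef x (pV a w)).
Proof. by case: W_sub => _ _; apply. Qed.

Lemma pm_nu a w : W w -> W (nu V (pV a w)).
Proof. by move=> Ww; rewrite -xcoef_counit; apply: pm_xcoef. Qed.

(** A submodule is closed under $x$-products only by definition; [tens2_expand] writes $a.w$ as an
    $H$-combination of these. *)
Lemma pm_mu a w : W w -> W (mu V (pV a w)).
Proof.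
move=> Ww; have [s [_ sE]] := tens2_expand B (pV a w).
rewrite (sE (undup s)) ?undup_uniq // => [|I]; last by rewrite mem_undup.
rewrite (linear_sum (mu V)); apply: subspace_sum pm_subspace _ => I.
by rewrite mu_pure; apply: pm_hact; apply: pm_xcoef.
Qed.

Lemma pm_coinv w : W w -> W (coinv w).
Proof. by move=> Ww; rewrite coinvE dotE; apply: pm_mu. Qed.

(** The reconstruction formula with its coefficients taken to be $x$-products of $w$, so that they
    stay in [W]. *)
Lemma pm_expand w : W w -> proj w = w -> exists s : seq (H * V),
  (forall p, p \in s -> W p.2) /\ w = \sum_(p <- s) hact p.1 (coinv p.2).
Proof.
move=> Ww pw; have [s [_ sE]] := tens2_expand B (pV (tl e) w).
have {}sE := sE _ (undup_uniq s) (fun I Is => etrans (mem_undup s I) Is).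
exists [seq (dd J, xcoef (db_t B J) (pV (tl e) w)) | J <- undup s].
split=> [p /mapP[I _ ->]|]; first exact: pm_xcoef.
rewrite big_map -{1}pw -(theta_proj e_id pm_lin pm_bil pm_ass).
rewrite {1}sE (linear_sum (theta pm_lin pm_bil (tl e))); apply: eq_bigr => I _.
by rewrite theta_pure aS_pure ue_SS mul1r.
Qed.

End Sub.

Variables (M : amodule A) (phi : {linear free_hmod H M -> V}).
Hypotheses (M_unit : unitary e M) (phi_inj : injective phi).
Hypothesis phiH : forall h u, phi (hact h u) = hact h (phi u).
Hypothesis phi_prod : forall a u, pV a (phi u) = map2 phi (tilde_prod a u).

Local Notation ceval := (xeval M (counit H)).

Lemma pV_phi a (m : M) :
  pV (tl a) (phi (tl m)) = tp2 (t2 1 1) (phi (tilde_dot a m)).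
Proof.
by rewrite phi_prod (map2E phiH) (tilde_prod_pure D e_id) map2L_pure.
Qed.

(** Since $t^I(1)=\langle t^I,1\rangle 1$, the sum is the PBW expansion of $1\in H$ applied to
    $\tilde m$. *)
Lemma tilde_dot_e (m : M) : tilde_dot e m = tl m.
Proof.
have [_ _ xe] := e_id; have [s [s0 sE]] := pbw_expand B 1.
have e0 I : I \notin undup s -> act I e = 0.
  by rewrite mem_undup xe => /s0 ->; rewrite scale0r.
rewrite (tilde_dotE _ (undup_uniq s) e0).
have -> : tl m = hact (1 : H) (tl m) by rewrite hact1.
rewrite {1}(sE (undup s)) ?undup_uniq // => [|I]; last by rewrite mem_undup.
rewrite hact_suml; apply: eq_bigr => I _.
by rewrite xe (bilinZl (am_bilinear M)) M_unit /tilde tprodZr hactZr [in RHS]hactZl.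
Qed.

Lemma coinv_phi u : coinv (phi u) = phi (tl (ceval u)).
Proof.
elim/tilde_ind: u => [|x y hx hy|h m].
- by rewrite !linear0 tilde0 linear0.
- by rewrite !linearD hx hy /tilde tprodDr linearD.
rewrite hact_tilde xeval_pure -hact_tilde phiH (coinvH e pm_lin pm_bil).
rewrite coinvE dotE pV_phi tilde_dot_e mu_pure epsr_pure ue_eps1 scale1r hact1.
by rewrite /tilde tprodZr linearZZ.
Qed.

Lemma proj_phi u : proj (phi u) = phi u.
Proof.
elim/tilde_ind: u => [|x y hx hy|h m].
- by rewrite !linear0.
- by rewrite !linearD hx hy.
rewrite phiH (projH e pm_lin pm_bil) projE pV_phi tilde_dot_e nu_pure.
by rewrite epsl_pure ue_eps1 scale1r hact1.
Qed.

(** Recovers the action of $A$ from operations that preserve submodules of [V]; the sum that appears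
    is evaluated by [act_expand]. *)
Lemma coinv_dot_phi a (m : M) :
  coinv (nu V (pV (tl a) (phi (tl m)))) = phi (tl (am_act a m)).
Proof.
rewrite pV_phi nu_pure epsl_pure ue_eps1 scale1r hact1 coinv_phi.
congr (phi (tl _)); have [s [us s0 _]] := act_support2 D e_id a a.
rewrite (tilde_dotE _ us s0) (linear_sum (xeval M (counit H))).
rewrite -[in RHS](act_expand D e_id us s0) (bilin_suml (am_bilinear M)).
apply: eq_bigr => I _.
by rewrite hact_tilde xeval_pure (bilinZl (am_bilinear M)).
Qed.

(* [W |-> {m | 1 (x) m \in W}] and [N |-> H (x) N], mutually inverse. *)
Definition restr (W : set V) : set M := [set m | W (phi (tl m))].

(** The additive span of the $h\otimes n$, encoded so that membership is its own induction
    principle; scalars are absorbed by $h$. *)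
Definition free_sub (N : set M) : set (free_hmod H M) :=
  [set u | forall Q : set (free_hmod H M), Q 0 ->
     (forall x y, Q x -> Q y -> Q (x + y)) ->
     (forall h n, N n -> Q (tprod h n)) -> Q u].

Definition extend (N : set M) : set V := phi @` free_sub N.

Lemma restr_sub W : pm_submodule W -> am_submodule (restr W).
Proof.
move=> sW; split; last first.
  move=> a m Wm; rewrite /restr /= -coinv_dot_phi.
  by apply: (pm_coinv sW); apply: (pm_nu sW).
split=> [|k m n Wm Wn]; rewrite /restr /=.
  by rewrite tilde0 linear0; case: (pm_subspace sW).
by rewrite tilde_lin linearP; apply: (pm_subspace sW).2.
Qed.

Lemma free_sub0 N : free_sub N 0.
Proof. by move=> Q. Qed.

Lemma free_subD N x y : free_sub N x -> free_sub N y -> free_sub N (x + y).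
Proof. by move=> hx hy Q Q0 QD Qt; apply: (QD); [apply: (hx Q)|apply: (hy Q)]. Qed.

Lemma free_sub_pure N h n : N n -> free_sub N (tprod h n).
Proof. by move=> Nn Q _ _; apply. Qed.

Lemma free_sub_hact N h u : free_sub N u -> free_sub N (hact h u).
Proof.
move=> /(_ (fun u => free_sub N (hact h u))); apply.
- by rewrite hact0r; apply: free_sub0.
- by move=> x y hx hy; rewrite hactDr; apply: free_subD.
move=> f n Nn; rewrite -hact_tilde -hactM hact_tilde.
exact: free_sub_pure.
Qed.

Lemma free_subZ N k u : free_sub N u -> free_sub N (k *: u).
Proof.
have -> : k *: u = hact (k *: 1 : H) u by rewrite hactZl hact1.
exact: free_sub_hact.
Qed.

Section Extend.
Variable N : set M.
Hypothesis N_sub : am_submodule N.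

Lemma extend_subspace : subspace (extend N).
Proof.
split=> [|k _ _ [u hu <-] [v hv <-]].
  by exists 0; [apply: free_sub0|rewrite linear0].
exists (k *: u + v); last by rewrite linearP.
by apply: free_subD => //; apply: free_subZ.
Qed.

Lemma extend_hact h w : extend N w -> extend N (hact h w).
Proof.
by move=> [u hu <-]; exists (hact h u) => //; apply: free_sub_hact.
Qed.

Lemma extend_tilde_dot a n : N n -> extend N (phi (tilde_dot a n)).
Proof.
move=> Nn; have [s [us s0 _]] := act_support2 D e_id a a.
rewrite (tilde_dotE _ us s0) linear_sum.
apply: subspace_sum extend_subspace _ => I; rewrite phiH.
apply: extend_hact; exists (tl (am_act (act I a) n)) => //.
by apply: free_sub_pure; apply: N_sub.2.
Qed.

Lemma extend_xcoef_pure x be w : extend N w -> extend N (xcoef x (tp2 be w)).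
Proof.
move=> Nw; rewrite xcoefE left_form_pure.
elim/tensor_ind: (twist be) => [|a b ha hb|h k].
- by rewrite !linear0; case: extend_subspace.
- by rewrite !linearD; apply: subspaceD extend_subspace _ _.
rewrite act2_pure xeval_pure; apply: subspaceZ extend_subspace _.
exact: extend_hact.
Qed.

Lemma extend_sub : pm_submodule (extend N).
Proof.
split; [exact: extend_subspace|exact: extend_hact|].
move=> a x _ [u hu <-]; change (extend N (xcoef x (pV a (phi u)))).
have x0 : xcoef x (0 : tens2 V) = 0 by rewrite xcoefE !linear0.
have xD (al be : tens2 V) : xcoef x (al + be) = xcoef x al + xcoef x be.
  by rewrite !xcoefE !linearD.
apply: (hu (fun u => extend N (xcoef x (pV a (phi u))))) => [|y z hy hz|h n Nn].
- by rewrite linear0 (bilin0r pm_lin) x0; case: extend_subspace.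
- rewrite linearD (bilinDr pm_lin) xD.
  exact: subspaceD extend_subspace _ _.
elim/tilde_ind: a => [|y z hy hz|f a].
- by rewrite (bilin0l pm_lin) x0; case: extend_subspace.
- rewrite (bilinDl pm_lin) xD.
  exact: subspaceD extend_subspace _ _.
rewrite -hact_tilde phiH pm_bil pV_phi lact2E lact2L_pure.
by apply: extend_xcoef_pure; apply: extend_tilde_dot.
Qed.

Lemma extend_range : extend N `<=` range phi.
Proof. by move=> _ [u _ <-]; exists u. Qed.

(** By injectivity of [phi] it suffices that $\varepsilon\otimes\mathrm{id}$ maps $H\otimes N$ into
    $N$ and $1\otimes m$ to $m$. *)
Lemma extendK : restr (extend N) = N.
Proof.
apply/seteqP; split=> [m [u hu /phi_inj um]|m Nm]; last first.
  by exists (tl m) => //; apply: free_sub_pure.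
rewrite -[m](@xeval_counit_tilde _ _ H) -um.
apply: (hu (fun u => N (ceval u))) => [|x y hx hy|h n Nn].
- by rewrite linear0; case: N_sub => -[].
- by rewrite linearD; apply: subspaceD N_sub.1 _ _.
by rewrite xeval_pure; apply: subspaceZ N_sub.1 _.
Qed.

End Extend.

(** A submodule inside the range is generated over $H$ by its intersection with $M$: by [pm_expand]
    each $w$ is a sum of $h\cdot Pw'$ with $w'$ in $W$, and $Pw'$ lies in both $W$ and $M$. *)
Lemma restrK W : pm_submodule W -> W `<=` range phi -> extend (restr W) = W.
Proof.
move=> sW WV; apply/seteqP; split=> [_ [u hu <-]|w Ww].
  apply: (hu (fun u => W (phi u))) => [|x y hx hy|h n Wn].
  - by rewrite linear0; case: (pm_subspace sW).
  - by rewrite linearD; apply: subspaceD (pm_subspace sW) _ _.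
  by rewrite -hact_tilde phiH; apply: pm_hact.
have pw : proj w = w by have [u _ <-] := WV _ Ww; apply: proj_phi.
have [s [Ws ->]] := pm_expand sW Ww pw.
have sE := extend_subspace (restr W).
rewrite big_seq; apply: (big_ind (extend (restr W))).
- by case: sE.
- by move=> x y; apply: subspaceD.
move=> p /Ws Wp; apply: extend_hact; have [u _ up] := WV _ Wp.
rewrite -up coinv_phi; exists (tl (ceval u)) => //.
by apply: free_sub_pure; rewrite /restr /= -coinv_phi up; apply: pm_coinv.
Qed.

Lemma restr_range : restr (range phi) = setT.
Proof. by apply/seteqP; split=> // m _; exists (tl m). Qed.

Lemma extendT : extend setT = range phi.
Proof.
apply/seteqP; split; first exact: extend_range.
move=> _ [u _ <-]; exists u => //.
elim/tensor_ind: u => [|x y hx hy|h m]; first exact: free_sub0.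
  exact: free_subD.
exact: free_sub_pure.
Qed.

Lemma restr0 : restr [set 0] = [set 0].
Proof.
apply/seteqP; split=> m; rewrite /restr /=; last first.
  by move=> ->; rewrite tilde0 linear0.
rewrite -[X in _ = X -> _](linear0 phi) -(tilde0 H M).
by move=> /phi_inj /tilde_inj.
Qed.

Lemma pm_submodule0 : pm_submodule ([set 0] : set V).
Proof.
split; first by split=> [//|k u v /= -> ->]; rewrite scaler0 addr0.
  by move=> h w /= ->; apply: hact0r.
move=> a x w /= ->; rewrite (bilin0r (pm_linear V)) xcoefE.
by rewrite !linear0.
Qed.

Lemma extend0 : extend [set 0] = [set 0].
Proof.
rewrite -restr0 restrK //; first exact: pm_submodule0.
by move=> _ ->; exists 0 => //; rewrite linear0.
Qed.

Lemma irreducible_range :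
  irreducible (@pm_submodule _ _ _ _ V) (range phi) <->
  irreducible (@am_submodule _ _ _ _ _ M) setT.
Proof.
split=> irr.
  move=> N sN _; have [|||] := irr (extend N).
  - exact: extend_sub.
  - exact: extend_range.
  - by move=> N0; left; rewrite -(extendK sN) N0 restr0.
  by move=> NT; right; rewrite -(extendK sN) NT restr_range.
move=> W sW WV; have [||W0|WT] := irr (restr W) => //; first exact: restr_sub.
  by left; rewrite -(restrK sW WV) W0 extend0.
by right; rewrite -(restrK sW WV) WT extendT.
Qed.

Lemma indecomposable_range :
  indecomposable (@pm_submodule _ _ _ _ V) (range phi) <->
  indecomposable (@am_submodule _ _ _ _ _ M) setT.
Proof.
split=> ind [].
  move=> N1 [N2 [s1 s2 n1 n2 [NT N0]]]; apply: ind.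
  exists (extend N1), (extend N2); split; try exact: extend_sub.
  - by move=> E; apply: n1; rewrite -(extendK s1) E restr0.
  - by move=> E; apply: n2; rewrite -(extendK s2) E restr0.
  split.
    apply/seteqP; split=> [_ [u _ <-]|_ [_ [u _ <-] [_ [v _ <-] <-]]]; last first.
      by exists (u + v) => //; rewrite linearD.
    elim/tilde_ind: u => [|x y [a1 h1 [a2 h2 ex]] [b1 k1 [b2 k2 ey]]|h m].
    + exists 0; first by case: (extend_subspace N1).
      exists 0; first by case: (extend_subspace N2).
      by rewrite linear0 addr0.
    + exists (a1 + b1); first exact: subspaceD (extend_subspace N1) _ _.
      exists (a2 + b2); first exact: subspaceD (extend_subspace N2) _ _.
      by rewrite linearD -ex -ey addrACA.
    have [m1 h1 [m2 h2 <-]] : [set u + v | u in N1 & v in N2] m by rewrite -NT.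
    exists (phi (tprod h m1)); first by exists (tprod h m1) => //; apply: free_sub_pure.
    exists (phi (tprod h m2)); first by exists (tprod h m2) => //; apply: free_sub_pure.
    by rewrite hact_tilde tprodDr linearD.
  (* The intersection is a submodule inside the range whose restriction is $N_1\cap N_2=0$, so it is
     zero by [restrK]. *)
  pose W := extend N1 `&` extend N2.
  have sW : pm_submodule W.
    have [[z1 l1] k1 x1] := extend_sub s1; have [[z2 l2] k2 x2] := extend_sub s2.
    split; first split=> //.
    - by move=> k u v [? ?] [? ?]; split; [apply: l1|apply: l2].
    - by move=> h w [? ?]; split; [apply: k1|apply: k2].
    by move=> a x w [? ?]; split; [apply: x1|apply: x2].
  rewrite -/W -(restrK sW) => [|w [w1 _]]; last exact: extend_range w1.
  have -> : restr W = N1 `&` N2 by rewrite -[in RHS](extendK s1) -[in RHS](extendK s2).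
  by rewrite N0 extend0.
move=> W1 [W2 [s1 s2 n1 n2 [WT W0]]]; apply: ind.
have WV1 : W1 `<=` range phi.
  by rewrite WT => w Ww; exists w => //; exists 0; rewrite ?addr0 //; case: (pm_subspace s2).
have WV2 : W2 `<=` range phi.
  by rewrite WT => w Ww; exists 0; [case: (pm_subspace s1)|exists w; rewrite ?add0r].
exists (restr W1), (restr W2); split; try exact: restr_sub.
- by move=> E; apply: n1; rewrite -(restrK s1 WV1) E extend0.
- by move=> E; apply: n2; rewrite -(restrK s2 WV2) E extend0.
split; last by rewrite -restr0 -W0.
apply/seteqP; split=> // m _.
have [w1 h1 [w2 h2 w12]] : [set u + v | u in W1 & v in W2] (phi (tl m)).
  by rewrite -WT; exists (tl m).
have [u1 _ e1] := WV1 _ h1; have [u2 _ e2] := WV2 _ h2.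
(* The components of $m$ are the images under $\varepsilon\otimes\mathrm{id}$ of those of $1\otimes
   m$; they restrict correctly because submodules are stable under [coinv]. *)
exists (ceval u1); first by rewrite /restr /= -coinv_phi e1; apply: pm_coinv.
exists (ceval u2); first by rewrite /restr /= -coinv_phi e2; apply: pm_coinv.
rewrite -linearD; have /phi_inj -> : phi (u1 + u2) = phi (tl m).
  by rewrite linearD e1 e2.
exact: xeval_counit_tilde.
Qed.

End Submodules.

(** * The splitting of $V$ by the projection [proj], and the theorem *)

Section Splitting.
Variables (K : fieldType) (g : lie_algebra K) (H : enveloping g).
Variables (B : dual_bases H) (A : xcop_algebra B) (e : A) (D : Diff A).
Hypothesis e_id : xcop_identity e.
Variable V : pseudomodule (diff_pseudoalgebra D).

Local Notation V_lin := (pm_lin V).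
Local Notation V_bil := (@pm_bil _ _ _ _ _ _ V).
Local Notation V_ass := (@pm_ass _ _ _ _ _ _ V).
Local Notation proj := (proj e V_lin).

Lemma proj_kernel_prod (a : diff_pseudoalgebra D) (v : V) :
  proj v = 0 -> pm_prod a v = 0.
Proof.
move=> v0; rewrite -[LHS](pV_proj e_id V_lin V_bil V_ass).
by rewrite v0 (bilin0r V_lin).
Qed.

Lemma proj_kernel_sub : pm_submodule [set v : V | proj v = 0].
Proof.
split=> [|h w w0|a x w w0].
- split=> [|k u v u0 v0]; first exact: linear0.
  by rewrite /mkset linearP (u0 : proj u = 0) (v0 : proj v = 0) scaler0 addr0.
- by rewrite /mkset (projH e V_lin V_bil) (w0 : proj w = 0) hact0r.
by rewrite (proj_kernel_prod _ w0) /mkset xcoefE !linear0.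
Qed.

(** By [xcoef_map2] the projection commutes with taking $x$-products, and by [map2_proj] it fixes
    the coefficients of every pseudoproduct. *)
Lemma proj_image_sub : pm_submodule [set v : V | proj v = v].
Proof.
split=> [|h w ww|a x w ww].
- split=> [|k u v uu vv]; first exact: linear0.
  by rewrite /mkset linearP (uu : proj u = u) (vv : proj v = v).
- by rewrite /mkset (projH e V_lin V_bil) (ww : proj w = w).
rewrite /mkset -(xcoef_map2 (projH e V_lin V_bil)).
by rewrite (map2_proj e_id V_lin V_bil V_ass).
Qed.

Lemma proj_direct_sum :
  direct_sum setT [set v : V | proj v = 0] [set v : V | proj v = v].
Proof.
have pp := proj_proj e_id V_lin V_bil V_ass.
split.
  apply/seteqP; split=> // v _; exists (v - proj v).
    by rewrite /mkset linearB pp subrr.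
  by exists (proj v); [exact: pp|rewrite subrK].
apply/seteqP; split=> [v [/= v0 <-] //|v ->].
by split; apply: linear0.
Qed.

End Splitting.

Theorem theorem0p2 (R : realType) (g : lie_algebra R[i]) (H : enveloping g)
    (B : dual_bases H) (A : xcop_algebra B) (e : A) (he : xcop_identity e)
    (D : Diff A) (V : pseudomodule (diff_pseudoalgebra D)) :
  (exists (V0 V1 : set V) (M : amodule A), decomposition e V0 V1 M) /\
  (forall (V0 V1 : set V) (M : amodule A), decomposition e V0 V1 M ->
    (irreducible (@pm_submodule _ _ _ _ V) V1 <->
       irreducible (@am_submodule _ _ _ _ _ M) setT) /\
    (indecomposable (@pm_submodule _ _ _ _ V) V1 <->
       indecomposable (@am_submodule _ _ _ _ _ M) setT)).
Proof.
pose V_lin := pm_lin V; pose V_bil := @pm_bil _ _ _ _ _ _ V.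
pose V_ass := @pm_ass _ _ _ _ _ _ V.
split.
  exists [set v | proj e V_lin v = 0], [set v | proj e V_lin v = v].
  exists (coinv_amodule he V_lin V_bil V_ass); split.
  - by split; [apply: proj_kernel_sub|apply: proj_image_sub].
  - exact: proj_direct_sum.
  - by move=> a v; apply: proj_kernel_prod.
  - exact: coinv_unitary.
  exists (span_map he V_lin V_bil V_ass); split.
  - exact: span_map_inj.
  - exact: range_span_map.
  - exact: span_mapH.
  exact: pV_span_map.
(* In any decomposition $V^1$ is the range of the given [phi], so the correspondence of submodules
   applies to it directly. *)
move=> V0 V1 M [_ _ _ M_unit [phi [phi_inj <- phiH phi_prod]]].
split; first exact: (irreducible_range he M_unit phi_inj phiH phi_prod).
exact: (indecomposable_range he M_unit phi_inj phiH phi_prod).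
Qed.
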